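(* Fix numbers $\kappa>0$ and $0<\delta<1$. Then there exists a number $q=q(\kappa,\delta)$ such that the following holds. Let $m,n$ be integers with $n\ge m>q$, let $R=(r_1,\ldots,r_m)$, $C=(c_1,\ldots,c_n)$ be vectors of positive integers with $\sum_ir_i=\sum_jc_j$, $0<r_i<n$, $0<c_j<m$, and let $W=(w_{ij})$ be an $m\times n$ matrix with entries in $\{0,1\}$. Let $\mathcal{P}(R,C;W)$ be the polytope of real $m\times n$ matrices $X=(x_{ij})$ with row sums $R$, column sums $C$, $0\le x_{ij}\le1$, and $x_{ij}=0$ whenever $w_{ij}=0$, and suppose it contains a matrix $Y=(y_{ij})$ with $0<y_{ij}<1$ whenever $w_{ij}=1$. Let $Z$ be the unique maximizer on $\mathcal{P}(R,C;W)$ of $H(X)=\sum_{i,j}\big(x_{ij}\ln\frac1{x_{ij}}+(1-x_{ij})\ln\frac1{1-x_{ij}}\big)$. Let $S\subset\{(i,j):w_{ij}=1\}$ satisfy $\sigma_S(Z)\ge\delta mn$ and let $\epsilon=\delta\frac{\ln n}{\sqrt m}$. If $\epsilon\le1$, then for $D$ chosen uniformly at random from the set $\Sigma(R,C;W)$ of $m\times n$ 0-1 matrices with row sums $R$, column sums $C$ and $d_{ij}=0$ whenever $w_{ij}=0$, $$\Pr\big\{(1-\epsilon)\sigma_S(Z)\le\sigma_S(D)\le(1+\epsilon)\sigma_S(Z)\big\}\ \ge\ 1-2n^{-\kappa n}.$$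
   Context: For a subset $S$ of index pairs and an $m\times n$ matrix $A=(a_{ij})$, $\sigma_S(A)=\sum_{(i,j)\in S}a_{ij}$. The convention $0\ln\frac10=0$ is used in $H$. *)

(* Defs.v *)
From HB Require Import structures.
From mathcomp Require Export all_boot all_order all_algebra.
From mathcomp Require Export classical_sets reals exp.

Set Implicit Arguments.
Unset Strict Implicit.
Unset Printing Implicit Defensive.
Import Order.TTheory GRing.Theory Num.Theory.
Local Open Scope ring_scope.

Definition sigma (R : realType) (m n : nat) (S : {set 'I_m * 'I_n})
    (A : 'M[R]_(m, n)) : R :=
  \sum_(p in S) A p.1 p.2.

(** The polytope P(R, C; W); a 0-1 matrix is encoded as a boolean matrix. *)
Definition polytope (R : realType) (m n : nat) (r : 'I_m -> nat)
    (c : 'I_n -> nat) (W : 'M[bool]_(m, n)) : set 'M[R]_(m, n) :=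
  [set X | [/\ forall i, \sum_j X i j = (r i)%:R,
               forall j, \sum_i X i j = (c j)%:R,
               forall i j, 0 <= X i j <= 1 &
               forall i j, W i j = false -> X i j = 0]]%classic.

(** The convention 0 ln (1/0) = 0 holds automatically because of the factor 0
    ([_^-1] and [ln] are total). *)
Definition entropy (R : realType) (m n : nat) (X : 'M[R]_(m, n)) : R :=
  \sum_i \sum_j (X i j * ln (1 / X i j) + (1 - X i j) * ln (1 / (1 - X i j))).

Definition is_maximizer (R : realType) (T : Type) (P : set T) (f : T -> R)
    (z : T) : Prop :=
  P z /\ forall x, P x -> f x <= f z.

(** The set Sigma(R, C; W). *)
Definition zero_one_matrices (m n : nat) (r : 'I_m -> nat) (c : 'I_n -> nat)
    (W : 'M[bool]_(m, n)) : {set 'M[bool]_(m, n)} :=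
  [set D : 'M[bool]_(m, n) |
    [&& [forall i, (\sum_j D i j)%N == r i],
        [forall j, (\sum_i D i j)%N == c j] &
        [forall i, forall j, ~~ W i j ==> ~~ D i j]]].

Definition real_mx (R : realType) (m n : nat) (D : 'M[bool]_(m, n)) :
    'M[R]_(m, n) :=
  map_mx (fun b : bool => b%:R) D.

(** Probability of [E] for the uniform distribution on [A]; it is 0 when [A] is
    empty, so a positive lower bound entails that [A] is nonempty. *)
Definition uniform_pr (R : realType) (T : finType) (A : {set T})
    (E : pred T) : R :=
  #|[set x in A | E x]|%:R / #|A|%:R.

(* Main.v *)
(** For the uniform distribution on Sigma(R, C; W), compare with independent
    Bernoulli entries of mean [Z]. The first-order optimality of [Z] gives each
    [D] in Sigma(R, C; W) Bernoulli weight at least [exp (- H Z)], and Chernoff's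
    bound makes the deviations of [sigma S] have Bernoulli probability at most
    [2 exp (- epsilon^2 sigma_S(Z) / 8)], hence [n^(- Omega (n ln n))]. It remains to
    show [exp (H Z) <= (n+1)^m (m+1)^n |Sigma(R, C; W)|], a loss of [n^(O(n))].

    This is a capacity argument in the style of Gurvits. Weighted AM-GM gives
    [exp (H Z) x^R y^C <= prod_(w_ij = 1) (1 + x_i y_j)] for all positive x, y,
    and the coefficient of [x^R y^C] on the right is [|Sigma(R, C; W)|]. The
    coefficient is extracted one variable at a time: a log-concave sequence of
    length N+1 whose generating polynomial dominates [K t^c] has its c-th term at
    least [K / (N+1)]. The log-concavity needed at each step is proved
    combinatorially, by exchanging two edge sets along alternating trails. *)

Require Import Defs.
From mathcomp Require Import classical_sets reals sequences exp.
From mathcomp Require Import all_boot all_order all_algebra all_fingroup.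
From mathcomp Require Import zify ring lra.

Set Implicit Arguments.
Unset Strict Implicit.
Unset Printing Implicit Defensive.
Import Order.TTheory GRing.Theory Num.Theory.

(** * Alternating trails *)

Section Trails.
Variable E : finType.

(** The condition fails at a fixed point of [p] in [T], so it makes [p] free of fixed points on
    [T]. *)
Definition alternates (T M : {set E}) (p : {perm E}) :=
  [forall e in T, (p e \in M) == (e \notin M)].

Definition symdiff (A B : {set E}) := (A :\: B) :|: (B :\: A).

Lemma in_symdiff A B e : (e \in symdiff A B) = (e \in A) (+) (e \in B).
Proof. by rewrite !inE; case: (e \in A); case: (e \in B). Qed.

Lemma symdiffK A B : symdiff (symdiff A B) B = A.
Proof. by apply/setP => e; rewrite !in_symdiff -addbA addbb addbF. Qed.

Variables (p q : {perm E}) (Tp Tq S J : {set E}).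
Hypotheses (pK : involutive p) (qK : involutive q).
Hypotheses (pT : forall e, e \notin Tp -> p e = e).
Hypotheses (qT : forall e, e \notin Tq -> q e = e).
Hypotheses (TpS : Tp \subset S) (TqS : Tq \subset S) (JS : J \subset S).
Hypothesis (JTq : forall e, e \in J -> e \notin Tq).

Let h : {perm E} := (p * q)%g.

Let hE x : h x = q (p x). Proof. by rewrite permM. Qed.

(** For [e] in [J], which [q] fixes, the orbit of the rotation [p * q] alone is already stable under
    [p] and [q]: it is the orbit of the dihedral group they generate. *)
Definition trail e := porbit h e.

Let stable_h (A : {set E}) e i : (forall x, x \in A -> h x \in A) -> e \in A ->
  (h ^+ i)%g e \in A.
Proof. by move=> hA eA; elim: i => [|i IH]; rewrite ?perm1 // expgSr permM hA. Qed.


Let pow_involution (s : {perm E}) i x : involutive s -> (h ^ s = h^-1)%g ->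
  s ((h ^+ i)%g x) = (h ^- i)%g (s x).
Proof.
move=> sK hs; rewrite -!permM conjgC conjXg hs.
by rewrite expgVn.
Qed.

Let mulK (s : {perm E}) : involutive s -> (s * s = 1)%g.
Proof. by move=> sK; apply/permP => x; rewrite permM sK perm1. Qed.

(** The dihedral relation: conjugation by either involution inverts their product. *)
Let conj_p : (h ^ p = h^-1)%g.
Proof.
have pV : (p^-1 = p)%g by apply/eqP; rewrite eq_invg_mul mulK.
have qV : (q^-1 = q)%g by apply/eqP; rewrite eq_invg_mul mulK.
by rewrite conjgE /h invMg pV qV !mulgA mulK // mul1g.
Qed.

Let conj_q : (h ^ q = h^-1)%g.
Proof.
have pV : (p^-1 = p)%g by apply/eqP; rewrite eq_invg_mul mulK.
have qV : (q^-1 = q)%g by apply/eqP; rewrite eq_invg_mul mulK.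
by rewrite conjgE /h invMg pV qV -!mulgA mulK // mulg1.
Qed.

Let q_J e : e \in J -> q e = e.
Proof. by move=> /JTq /qT. Qed.

Let q_pow e i : e \in J -> q ((h ^+ i)%g e) = (h ^- i)%g e.
Proof. by move=> eJ; rewrite pow_involution // q_J. Qed.

Let p_pow e i : e \in J -> p ((h ^+ i)%g e) = (h ^- i.+1)%g e.
Proof.
move=> eJ; rewrite pow_involution // expgSr invMg permM.
congr ((h ^- i)%g _); apply/(@perm_inj _ h).
by rewrite permKV hE pK q_J.
Qed.

Let pow_opp e i j : ((h ^+ i)%g e == (h ^- j)%g e) = ((h ^+ (i + j))%g e == e).
Proof. by rewrite -(inj_eq (@perm_inj _ (h ^+ j)%g)) permKV expgD permM. Qed.

Let trail_opp e i : (h ^- i)%g e \in trail e.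
Proof.
by rewrite /trail porbit_sym; have := mem_porbit h i ((h ^- i)%g e); rewrite permKV.
Qed.

Let trail_stable_p e x : e \in J -> (p x \in trail e) = (x \in trail e).
Proof.
move=> eJ; suff H y : y \in trail e -> p y \in trail e.
  by apply/idP/idP => /H //; rewrite pK.
by case/porbitP=> i ->; rewrite p_pow // trail_opp.
Qed.

Let trail_stable_q e x : e \in J -> (q x \in trail e) = (x \in trail e).
Proof.
move=> eJ; suff H y : y \in trail e -> q y \in trail e.
  by apply/idP/idP => /H //; rewrite qK.
by case/porbitP=> i ->; rewrite q_pow // trail_opp.
Qed.

Let stable_S (s : {perm E}) (T : {set E}) : involutive s -> (forall e, e \notin T -> s e = e) ->
  T \subset S -> forall x, x \in S -> s x \in S.
Proof.
move=> sK sT TS x xS; have [sxT|/sT] := boolP (s x \in T).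
  exact: (subsetP TS).
by rewrite sK => <-.
Qed.

Let trailS e : e \in J -> trail e \subset S.
Proof.
move=> eJ; apply/subsetP => x /porbitP[i ->]; apply: stable_h.
  by move=> y yS; rewrite hE (stable_S qK qT) // (stable_S pK pT).
exact: (subsetP JS).
Qed.

(* Past [e] a trail meets [J] again only halfway along the orbit of [p * q],
   because [q] reverses that orbit around [e]. *)
Let trail_return e f : e \in J -> f \in J -> f \in trail e -> f != e ->
  exists i, [/\ 0 < i, f = (h ^+ i)%g e, (h ^+ i.*2)%g e = e &
    forall l, 0 < l < i.*2 -> (h ^+ l)%g e != e]%N.
Proof.
move=> eJ fJ fe nfe.
have ex : exists i, (0 < i) && (f == (h ^+ i)%g e).
  by case/porbitP: fe nfe => [[|i]] ->; [rewrite perm1 eqxx | exists i.+1; rewrite eqxx].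
case: (ex_minnP ex) => i /andP[i0 /eqP fE] mini.
(* Since [q] fixes [f] too, [f] lies both [i] steps after [e] and [i] steps before it, so [i.*2] is
   a period. A shorter period would lead to [f] in fewer than [i] steps or identify [f] with [e]. *)
have fq : (h ^- i)%g e = f by rewrite -q_pow // -fE q_J.
have f2 : (h ^+ i.*2)%g e = e.
  by apply/eqP; rewrite -addnn -pow_opp -fE fq.
exists i; split=> // l /andP[l0 l2]; apply/negP => /eqP le.
have [li|il|li] := ltngtP l i.
- have := mini (i - l)%N; rewrite subn_gt0 li /=.
  have -> : f = (h ^+ (i - l))%g e by rewrite fE -{1}(subnKC (ltnW li)) expgD permM le.
  by rewrite eqxx; lia.
- have : (0 < l - i < i)%N by lia.
  case/andP=> li0 li; have := mini (l - i)%N; rewrite li0 -fq eq_sym pow_opp.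
  by rewrite (subnK (ltnW il)) le eqxx; lia.
- by move/eqP: nfe; apply; rewrite fE -li.
Qed.

(** Both [f] and [g] sit at half of the least period of [e]. *)
Let trail_return_uniq e f g : e \in J -> f \in J -> g \in J ->
  f \in trail e -> g \in trail e -> f != e -> g != e -> f = g.
Proof.
move=> eJ fJ gJ fe ge nfe nge.
have [i [i0 -> i2 ui]] := trail_return eJ fJ fe nfe.
have [j [j0 -> j2 uj]] := trail_return eJ gJ ge nge.
have [ij|ij|->//] := ltngtP i j.
- by have := uj i.*2; rewrite i2 eqxx => H; suff: false by []; apply: H; lia.
- by have := ui j.*2; rewrite j2 eqxx => H; suff: false by []; apply: H; lia.
Qed.

(** Walking from [e] to [f] applies [p] and [q] in turn, beginning and ending with [p]. Each step
    changes membership in [M], and the number of steps is odd. *)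
Let trail_return_colour M e f : alternates Tp M p -> alternates Tq M q ->
  e \in J -> f \in J -> f \in trail e -> f != e -> (f \in M) = (e \notin M).
Proof.
move=> /forall_inP aP /forall_inP aQ eJ fJ fe nfe.
have [i [i0 fE i2 ui]] := trail_return eJ fJ fe nfe.
(* Outside [Tp] the point would be fixed by [p], which would give [e] the period [j + j.+1], smaller
   than [i.*2]. *)
have stepp j : (j < i)%N -> ((h ^- j.+1)%g e \in M) = ((h ^+ j)%g e \notin M).
  move=> ji; rewrite -p_pow //; apply/eqP/aP/negP => /negP /pT/eqP.
  by rewrite p_pow // eq_sym pow_opp; apply/negP/ui; lia.
have stepq j : (0 < j < i)%N -> ((h ^- j)%g e \in M) = ((h ^+ j)%g e \notin M).
  move=> ji; rewrite -q_pow //; apply/eqP/aQ/negP => /negP /qT/eqP.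
  by rewrite q_pow // eq_sym pow_opp; apply/negP/ui; lia.
have const j : (j < i)%N -> ((h ^+ j)%g e \in M) = (e \in M).
  elim: j => [|j IH] ji; first by rewrite perm1.
  by apply: negb_inj; rewrite -stepq // stepp ?IH 1?ltnW.
have -> : f = (h ^- i)%g e by rewrite -q_pow // -fE q_J.
by case: i i0 {fE i2 ui} stepp stepq const => // i _ stepp _ const; rewrite stepp // const.
Qed.

(** Flipping [M] along the trail of such an edge changes [#|M :&: J|] by exactly one. *)
Definition open_edges := [set e in J | J :&: trail e == [set e]].

Let in_trail e : e \in trail e. Proof. exact: porbit_id. Qed.

Let openP e : e \in J -> e \notin open_edges ->
  exists2 f, f \in J & (f \in trail e) && (f != e).
Proof.
move=> eJ; rewrite inE eJ /= => neq; apply/exists_inP; apply: contraNT neq.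
rewrite negb_exists_in => /forall_inP H; apply/eqP/setP => f; rewrite !inE.
apply/andP/eqP => [[fJ fe]|-> //]; apply/eqP.
by move: (H _ fJ); rewrite fe /= negbK.
Qed.

Let trail_sym e f : (f \in trail e) = (e \in trail f).
Proof. exact: porbit_sym. Qed.

(** The closed edges of [J] come in pairs, two on each trail, and exactly one of each pair lies in
    [M]. *)
Let closed_edges_half M : alternates Tp M p -> alternates Tq M q ->
  (#|M :&: (J :\: open_edges)|.*2 = #|J :\: open_edges|)%N.
Proof.
move=> aP aQ; set C := J :\: open_edges.
(* On [C] a second edge always exists, so the default [e] is never returned there. *)
pose other e := odflt e [pick f in J | (f \in trail e) && (f != e)].
have otherP e : e \in C ->
    [/\ other e \in C, other e \in trail e & other e != e].
  rewrite inE => /andP[nO eJ]; have [f0 f0J f0e] := openP eJ nO.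
  rewrite /other; case: pickP => [f /and3P[fJ fe nf]|/(_ f0)] /=; last by rewrite f0J f0e.
  split=> //; rewrite inE fJ andbT inE fJ /=; apply/negP => /eqP/setP/(_ e).
  by rewrite !inE eJ -trail_sym fe eq_sym (negbTE nf).
have CJ e : e \in C -> e \in J by rewrite inE => /andP[].
have otherK : {in C, cancel other other}.
  move=> e eC; have [fC fe nf] := otherP e eC; have [gC gf ng] := otherP _ fC.
  apply: (@trail_return_uniq (other e)); rewrite ?CJ // 1?trail_sym //.
  by rewrite eq_sym.
have col e : e \in C -> (other e \in M) = (e \notin M).
  move=> eC; have [fC fe nf] := otherP e eC.
  by apply: trail_return_colour; rewrite ?CJ.
have inj : {in C &, injective other} := can_in_inj otherK.
have le1 : (#|M :&: C| <= #|C :\: M|)%N.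
  rewrite -(card_in_imset (f := other) (D := mem (M :&: C))); last first.
    by move=> x y /setIP[_ xC] /setIP[_ yC]; apply: inj.
  apply/subset_leq_card/subsetP => _ /imsetP[e /setIP[eM eC] ->].
  by have [fC _ _] := otherP e eC; rewrite inE fC andbT col // eM.
have le2 : (#|C :\: M| <= #|M :&: C|)%N.
  rewrite -(card_in_imset (f := other) (D := mem (C :\: M))); last first.
    by move=> x y /setDP[xC _] /setDP[yC _]; apply: inj.
  apply/subset_leq_card/subsetP => _ /imsetP[e /setDP[eC eM] ->].
  by have [fC _ _] := otherP e eC; rewrite inE fC andbT col // eM.
have := cardsID M C; rewrite setIC; lia.
Qed.

Let alternates_symdiff (s : {perm E}) T M (K : {set E}) : (forall x, (s x \in K) = (x \in K)) ->
  alternates T M s -> alternates T (symdiff M K) s.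
Proof.
move=> sK /forall_inP aM; apply/forall_inP => e eT.
by rewrite !in_symdiff sK (eqP (aM e eT)); case: (e \in M); case: (e \in K).
Qed.

Definition alternating k := [set M : {set E} |
  [&& M \subset S, alternates Tp M p, alternates Tq M q & #|M :&: J| == k]].

(** Consequently the number of open edges in [M] depends only on [#|M :&: J|]. *)
Let card_open M : alternates Tp M p -> alternates Tq M q ->
  (#|M :&: J|.*2 + #|open_edges| = #|M :&: open_edges|.*2 + #|J|)%N.
Proof.
move=> aP aQ; have half := closed_edges_half aP aQ.
have OJ : open_edges \subset J by apply/subsetP => e; rewrite inE => /andP[].
have := cardsID open_edges J; rewrite (setIidPr OJ).
have := cardsID open_edges (M :&: J); rewrite -setIA (setIidPr OJ) -setIDA.
lia.
Qed.

Let flip_card (M : {set E}) e k : e \in open_edges -> e \notin M -> #|M :&: J| = k ->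
  #|symdiff M (trail e) :&: J| = k.+1.
Proof.
rewrite inE => /andP[eJ /eqP/setP Oe] eM <-.
have -> : symdiff M (trail e) :&: J = e |: (M :&: J).
  apply/setP => f; have := Oe f; rewrite (in_setI f (symdiff _ _)) in_symdiff !inE.
  case fJ: (f \in J); rewrite ?andbT ?andbF /=.
    by move=> ->; case: eqP => [->|]; rewrite ?(negbTE eM) ?addbF.
  by rewrite orbF => <-.
by rewrite cardsU1 inE (negbTE eM).
Qed.

(* Flipping an open trail not starting in M maps [alternating k] to
   [alternating k.+1]; both sides are counted together with the trail. *)
Lemma card_alternating k : (k.*2.+2 <= #|J|)%N ->
  (#|alternating k| <= #|alternating k.+1|)%N.
Proof.
move=> kJ; have [->|[M0 M0k]] := set_0Vmem (alternating k); first by rewrite cards0.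
pose X := [set x : {set E} * E | (x.1 \in alternating k) && (x.2 \in open_edges :\: x.1)].
pose Y := [set x : {set E} * E | (x.1 \in alternating k.+1) && (x.2 \in open_edges :&: x.1)].
have card_pair l (F : {set E} -> {set E}) :
    #|[set x : {set E} * E | (x.1 \in alternating l) && (x.2 \in F x.1)]| =
    (\sum_(M in alternating l) #|F M|)%N.
  under eq_bigr do rewrite -sum1_card.
  by rewrite pair_big_dep -sum1dep_card.
have XY : (#|X| <= #|Y|)%N.
  pose g (x : {set E} * E) := (symdiff x.1 (trail x.2), x.2).
  have ginj : injective g.
    move=> [M e] [M' e'] [eqM ee]; rewrite -ee in eqM *.
    by rewrite -(symdiffK M (trail e)) eqM symdiffK.
  rewrite -(card_imset _ ginj); apply/subset_leq_card/subsetP => _ /imsetP[[M e] + ->].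
  rewrite inE /= inE => /andP[/and4P[MS aP aQ /eqP Mk] /setDP[eO eM]].
  have eJ : e \in J by move: eO; rewrite inE => /andP[].
  rewrite inE /= inE; apply/andP; split; last first.
    by rewrite inE eO in_symdiff (negbTE eM) in_trail.
  apply/and4P; split.
  - apply/subsetP => f; rewrite in_symdiff; have := subsetP (trailS eJ) f.
    have := subsetP MS f.
    by case: (f \in M); case: (f \in trail e); auto.
  - by apply: alternates_symdiff => // x; apply: trail_stable_p.
  - by apply: alternates_symdiff => // x; apply: trail_stable_q.
  - by apply/eqP; apply: flip_card.
have := M0k; rewrite inE => /and4P[_ aP0 aQ0 /eqP M0c].
(* Members of [alternating k] contain [o] open edges and, because [k.*2.+2 <= #|J|], miss at least
   [o.+1]. Members of [alternating k.+1] contain [o.+1]. The factor [o.+1] therefore cancels. *)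
pose o := #|M0 :&: open_edges|.
have := card_open aP0 aQ0; rewrite M0c -/o => oE.
have Xge : (#|alternating k| * o.+1 <= #|X|)%N.
  rewrite card_pair -sum_nat_const; apply: leq_sum => M; rewrite inE => /and4P[_ aP aQ /eqP Mc].
  have := card_open aP aQ; rewrite Mc; have := cardsID M open_edges; rewrite setIC; lia.
have Yle : (#|Y| <= #|alternating k.+1| * o.+1)%N.
  rewrite card_pair -sum_nat_const; apply: leq_sum => M; rewrite inE => /and4P[_ aP aQ /eqP Mc].
  have := card_open aP aQ; rewrite Mc setIC; lia.
by rewrite -(leq_pmul2r (ltn0Sn o)); apply: leq_trans Xge (leq_trans XY Yle).
Qed.

End Trails.

(** * Pairings *)

(** Equal fibre sizes make the value lists of [f] and [g] permutations of each other. *)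
Lemma exists_perm_fibres (E : finType) (K : eqType) (f g : E -> K) :
  (forall k, #|[pred e | f e == k]| = #|[pred e | g e == k]|) ->
  exists s : {perm E}, forall e, g (s e) = f e.
Proof.
move=> fg; pose ft := [tuple f (enum_val i) | i < #|E|].
pose gt := [tuple g (enum_val i) | i < #|E|].
have cnt (h : E -> K) k :
    count_mem k [tuple h (enum_val i) | i < #|E|] = #|[pred e | h e == k]|.
  rewrite /= count_map -sum1_count -[RHS]sum1_card (reindex_onto enum_val enum_rank) /=.
    by rewrite big_enum_cond /=; apply: eq_bigl => i; rewrite !inE enum_valK eqxx andbT.
  by move=> i _; rewrite enum_rankK.
have /tuple_permP[s fs] : perm_eq ft gt.
  by apply/allP => k _ /=; rewrite !cnt fg.
have inj : injective (fun e => enum_val (s (enum_rank e))).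
  by move=> x y /enum_val_inj/perm_inj/enum_rank_inj.
exists (perm inj) => e; rewrite permE.
have := congr1 (fun t => nth (f e) t (enum_rank e)) fs.
by rewrite -!tnth_nth !tnth_mktuple enum_rankK.
Qed.

Section Pairings.
Variables (E : finType) (U : eqType) (a : E -> U) (T : {set E}).

Definition pairings := [set p : {perm E} |
  [forall e, [&& p (p e) == e, a (p e) == a e & (e \notin T) ==> (p e == e)]]].

Definition balanced (M : {set E}) :=
  forall u, #|[set e in M :&: T | a e == u]|.*2 = #|[set e in T | a e == u]|.

(** Elements outside [T] get distinct keys, so a permutation matching keys fixes them; inside [T] it
    may only mix elements of the same fibre and colour. *)
Let key (M : {set E}) e : (U * bool) + E :=
  if e \in T then inl (a e, e \in M) else inr e.

Let card_key M u b : balanced M ->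
  #|[pred e | key M e == inl (u, b)]|.*2 = #|[set e in T | a e == u]|.
Proof.
move=> /(_ u) bM; have := cardsID M [set e in T | a e == u].
have -> : [set e in T | a e == u] :&: M = [set e in M :&: T | a e == u].
  by apply/setP => e; rewrite !inE andbC andbA.
have -> : #|[pred e | key M e == inl (u, b)]| =
    if b then #|[set e in M :&: T | a e == u]| else #|[set e in T | a e == u] :\: M|.
  rewrite -[#|_|]cardsE; case: b; congr #|pred_of_set _|; apply/setP => e; rewrite !inE /key;
  case eT: (e \in T); rewrite ?andbF //= ?andbT.
  - by rewrite [inl _ == _]/eq_op /= xpair_eqE andbC eqb_id.
  - by rewrite [inl _ == _]/eq_op /= xpair_eqE andbC eqbF_neg.
by case: b; lia.
Qed.

Let exists_key_perm M M' : balanced M -> balanced M' ->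
  exists s : {perm E}, [/\ forall e, a (s e) = a e, forall e, e \notin T -> s e = e,
    forall e, (s e \in T) = (e \in T) & forall e, e \in T -> (s e \in M') = (e \in M)].
Proof.
move=> bM bM'; have [|s sE] := @exists_perm_fibres E _ (key M) (key M').
  case=> [[u b]|e0].
    by apply: double_inj; rewrite !card_key.
  by apply: eq_card => e; rewrite !inE /key; case: ifP.
have sT e : e \notin T -> s e = e.
  by move=> eT; have := sE e; rewrite /key (negbTE eT); case: ifP => // _ [].
have sTT e : (s e \in T) = (e \in T).
  by have := sE e; rewrite /key; do 2!case: ifP.
have sI e : e \in T -> a (s e) = a e /\ (s e \in M') = (e \in M).
  by move=> eT; have := sE e; rewrite /key sTT eT => -[].
exists s; split=> // e; last by case/sI.
by have [/sI[]|/sT ->] := boolP (e \in T).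
Qed.

Let pairingP p : p \in pairings ->
  [/\ involutive p, forall e, a (p e) = a e & forall e, e \notin T -> p e = e].
Proof.
rewrite inE => /forallP H; split=> e; have /and3P[/eqP ? /eqP ? /implyP] // := H e.
by move=> /[apply] /eqP.
Qed.

(** Conjugation by a fibre-preserving permutation that carries [M] to [M'] within [T] maps one
    family of pairings injectively into the other. *)
Let card_alternates_le M M' : balanced M -> balanced M' ->
  (#|[set p in pairings | alternates T M p]| <=
   #|[set p in pairings | alternates T M' p]|)%N.
Proof.
move=> bM bM'; have [s [sa sT sTT sM]] := exists_key_perm bM bM'.
rewrite -(card_imset _ (conjg_inj s)); apply/subset_leq_card/subsetP.
move=> _ /imsetP[p + ->]; rewrite inE => /andP[/pairingP[pK pa pT] /forall_inP aM].
have cE e : (p ^ s)%g (s e) = s (p e) by rewrite permJ.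
have sur e : exists f, e = s f by exists ((s^-1)%g e); rewrite permKV.
rewrite inE; apply/andP; split.
  rewrite inE; apply/forallP => e; have [f ->] := sur e; rewrite !cE pK eqxx !sa pa eqxx /=.
  by apply/implyP; rewrite sTT => /pT ->.
apply/forall_inP => e; have [f ->] := sur e; rewrite sTT cE => fT.
have pfT : p f \in T.
  apply/negP => /negP npf; have := pT _ npf; rewrite pK => E1.
  by move: npf; rewrite -E1 fT.
by rewrite !sM // (eqP (aM f fT)).
Qed.

Lemma card_alternates M M' : balanced M -> balanced M' ->
  #|[set p in pairings | alternates T M p]| = #|[set p in pairings | alternates T M' p]|.
Proof. by move=> bM bM'; apply/eqP; rewrite eqn_leq !card_alternates_le. Qed.

Lemma balancedC M : balanced M -> balanced (~: M).
Proof.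
move=> bM u; have := bM u; have := cardsID M [set e in T | a e == u].
have -> : [set e in T | a e == u] :&: M = [set e in M :&: T | a e == u].
  by apply/setP => e; rewrite !inE andbC andbA.
have -> : [set e in T | a e == u] :\: M = [set e in ~: M :&: T | a e == u].
  by apply/setP => e; rewrite !inE andbA.
lia.
Qed.

(** The complement of [M] is balanced as well, so some [s] exchanges the two colours on [T]. Using
    [s] on [M] and its inverse off [M] yields an involution. *)
Lemma card_alternates_gt0 M : balanced M ->
  (0 < #|[set p in pairings | alternates T M p]|)%N.
Proof.
move=> bM; have [s [sa sT sTT sM]] := exists_key_perm bM (balancedC bM).
have sM' e : e \in T -> (s e \in M) = (e \notin M).
  by move=> /sM; rewrite inE => <-; rewrite negbK.
pose f e := if e \in M then s e else (s^-1)%g e.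
have sVT e : ((s^-1)%g e \in T) = (e \in T) by rewrite -{2}(permKV s e) sTT.
have sVn e : e \notin T -> (s^-1)%g e = e.
  by move=> eT; apply/(@perm_inj _ s); rewrite permKV sT.
have sVM e : e \in T -> ((s^-1)%g e \in M) = (e \notin M).
  by move=> eT; rewrite -{2}(permKV s e) sM' ?sVT // negbK.
have fK : involutive f.
  move=> e; rewrite /f; have [eT|eT] := boolP (e \in T); last first.
    by case eM: (e \in M); rewrite ?sT ?sVn // eM.
  case eM: (e \in M); first by rewrite sM' // eM /= permK.
  by rewrite sVM // eM /= permKV.
have fT e : e \in T -> (f e \in M) = (e \notin M).
  by move=> eT; rewrite /f; case: ifP => eM; rewrite ?sM' ?sVM // eM.
apply/card_gt0P; exists (perm (inv_inj fK)); rewrite !inE; apply/andP; split.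
  apply/forallP => e; rewrite !permE fK eqxx /=; apply/andP; split.
    by rewrite /f; case: ifP; rewrite ?sa // -[in X in _ == X](permKV s e) sa.
  by apply/implyP => eT; rewrite /f; case: ifP; rewrite ?sT ?sVn.
by apply/forall_inP => e eT; rewrite permE fT.
Qed.

(** Within each fibre of [a] in [T], [p] is a bijection between the part in [M] and the part
    outside. *)
Lemma alternates_balanced M p : p \in pairings -> alternates T M p -> balanced M.
Proof.
move=> /pairingP[pK pa pT] /forall_inP aM u.
have pTT e : e \in T -> p e \in T.
  move=> eT; apply/negP => /negP npf; have := pT _ npf; rewrite pK => E1.
  by move: npf; rewrite -E1 eT.
have -> : [set e in M :&: T | a e == u] = [set e in T | a e == u] :&: M.
  by apply/setP => e; rewrite !inE [in RHS]andbC andbA.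
rewrite -(cardsID M [set e in T | a e == u]) -addnn; congr addn.
rewrite -(card_imset _ (@perm_inj _ p)); congr #|pred_of_set _|; apply/setP => e.
apply/imsetP/idP => [[f] + ->|].
  rewrite !inE => /andP[/andP[fT /eqP <-] fM].
  by rewrite pTT // pa eqxx (eqP (aM f fT)) fM.
rewrite !inE => /and3P[eM eT /eqP eu]; exists (p e); last by rewrite pK.
by rewrite !inE pTT // pa eu eqxx (eqP (aM e eT)).
Qed.

End Pairings.

(** * Log-concavity *)

Definition deg (E : finType) (U : eqType) (a : E -> U) (A : {set E}) (u : U) : nat :=
  #|[set e in A | a e == u]|.

Lemma degID (E : finType) (U : eqType) (a : E -> U) (A B : {set E}) u :
  deg a A u = (deg a (A :&: B) u + deg a (A :\: B) u)%N.
Proof.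
rewrite /deg -(cardsID B [set e in A | a e == u]); congr addn;
by apply: eq_card => e; rewrite !inE; case: (e \in B); rewrite ?andbT ?andbF.
Qed.

(** * Subsets taking half of the degree at prescribed vertices *)

Section BalancedSubsets.
Variables (E U V : finType) (a : E -> U) (b : E -> V).
Variables (FU : {set U}) (FV : {set V}) (v : V) (S : {set E}).
Hypothesis vF : v \notin FV.

Definition half_at (W : finType) (c : E -> W) (F : {set W}) (M : {set E}) :=
  [forall u in F, (deg c M u).*2 == deg c S u].

Definition balanced_subsets k := [set M : {set E} |
  [&& M \subset S, half_at a FU M, half_at b FV M & deg b M v == k]].

Let active (W : finType) (c : E -> W) (F : {set W}) := [set e in S | c e \in F].

Let half_atP (W : finType) (c : E -> W) F (M : {set E}) : M \subset S ->
  half_at c F M <-> balanced c (active c F) M.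
Proof.
move=> MS.
have eqM u : u \in F -> #|[set e in M :&: active c F | c e == u]| = deg c M u.
  move=> uF; apply: eq_card => e; rewrite !inE; case: eqP => [->|]; rewrite ?andbF //.
  by rewrite uF !andbT; case: (boolP (e \in M)) => // /(subsetP MS) ->.
have eqS u : u \in F -> #|[set e in active c F | c e == u]| = deg c S u.
  move=> uF; apply: eq_card => e; rewrite !inE; case: eqP => [->|]; rewrite ?andbF //.
  by rewrite uF !andbT.
have eq0 (N : {set E}) u : u \notin F -> N \subset active c F -> #|[set e in N | c e == u]| = 0%N.
  move=> uF NT; apply/eqP; rewrite cards_eq0; apply/eqP/setP => e; rewrite !inE.
  apply/negP => /andP[/(subsetP NT)]; rewrite inE => /andP[_ cF] /eqP ce.
  by move: uF; rewrite -ce cF.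
split=> [/forall_inP H u|H].
  have [uF|uF] := boolP (u \in F); first by rewrite eqM // eqS // (eqP (H u uF)).
  by rewrite !eq0 // subsetIr.
by apply/forall_inP => u uF; rewrite -eqM // -eqS // H.
Qed.

Let Tu := active a FU.
Let Tv := active b FV.
Let J := [set e in S | b e == v].
Let weight p q k := #|alternating p q Tu Tv S J k|.
Let cu M := #|[set p in pairings a Tu | alternates Tu M p]|.
Let cv M := #|[set p in pairings b Tv | alternates Tv M p]|.

Let cardsJ (M : {set E}) : M \subset S -> #|M :&: J| = deg b M v.
Proof.
move=> MS; apply: eq_card => e; rewrite !inE andbA.
by case: (boolP (e \in M)) => // /(subsetP MS) ->.
Qed.

(** Double counting of triples [(M, p, q)]: a set [M] admits no alternating pair [(p, q)] unless it
    is half at [FU] and [FV], and then the number of pairs is the same as for [M0]. *)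
Let sum_weight M0 k : half_at a FU M0 -> half_at b FV M0 -> M0 \subset S ->
  (\sum_(p in pairings a Tu) \sum_(q in pairings b Tv) weight p q k =
   #|balanced_subsets k| * (cu M0 * cv M0))%N.
Proof.
move=> hu hv M0S.
have wE p q : weight p q k = (\sum_(M : {set E}) ((M \subset S) && (deg b M v == k)) *
    (alternates Tu M p * alternates Tv M q))%N.
  rewrite /weight -sum1_card big_mkcond /=; apply: eq_bigr => M _; rewrite inE.
  have [MS|//] := boolP (M \subset S); rewrite cardsJ //=.
  by case: (alternates Tu M p); case: (alternates Tv M q); case: (_ == k).
transitivity (\sum_(M : {set E}) ((M \subset S) && (deg b M v == k)) * (cu M * cv M))%N.
  under eq_bigr => p _ do under eq_bigr => q _ do rewrite wE.
  under eq_bigr => p _ do rewrite exchange_big /=.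
  rewrite exchange_big /=; apply: eq_bigr => M _.
  under eq_bigr => p _ do rewrite -big_distrr /=.
  rewrite -big_distrr /=; congr muln.
  under eq_bigr => p _ do rewrite -big_distrr /=.
  have cE (G : finType) (A P : pred G) : (\sum_(p in A) P p)%N = #|[set p in A | P p]|.
    rewrite -sum1_card big_mkcond [RHS]big_mkcond; apply: eq_bigr => p _; rewrite inE.
    by case: (p \in A); case: (P p).
  by rewrite -big_distrl /= !cE.
rewrite -sum_nat_const [RHS]big_mkcond /=; apply: eq_bigr => M _; rewrite inE.
have [MS|//] := boolP (M \subset S); rewrite /=.
have [hMu|hMu] := boolP (half_at a FU M); last first.
  suff -> : cu M = 0%N by rewrite mul0n muln0.
  apply/eqP; rewrite cards_eq0; apply/set0Pn => -[p]; rewrite inE => /andP[pP aM].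
  by move: hMu; rewrite (half_atP _ _ MS).2 //; apply: alternates_balanced aM.
have [hMv|hMv] := boolP (half_at b FV M); last first.
  suff -> : cv M = 0%N by rewrite !muln0.
  apply/eqP; rewrite cards_eq0; apply/set0Pn => -[p]; rewrite inE => /andP[pP aM].
  by move: hMv; rewrite (half_atP _ _ MS).2 //; apply: alternates_balanced aM.
have -> : cu M = cu M0 by apply: card_alternates; apply/half_atP.
have -> : cv M = cv M0 by apply: card_alternates; apply/half_atP.
by case: (_ == k); rewrite ?mul1n ?mul0n.
Qed.

(* Averaging over all ways of pairing, at every vertex of [FU] and [FV], the
   elements of [M] with those of [S :\: M] reduces this to [card_alternating]. *)
Lemma card_balanced_subsets k : (k.*2.+2 <= deg b S v)%N ->
  (#|balanced_subsets k| <= #|balanced_subsets k.+1|)%N.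
Proof.
move=> kS; have [->|[M0]] := set_0Vmem (balanced_subsets k); first by rewrite cards0.
rewrite inE => /and4P[M0S hu hv _].
have K0 : (0 < cu M0 * cv M0)%N.
  by rewrite muln_gt0 !card_alternates_gt0 //; apply/half_atP.
rewrite -(leq_pmul2r K0) -!sum_weight //.
apply: leq_sum => p pP; apply: leq_sum => q qP.
have pairP (W : finType) (c : E -> W) F (s : {perm E}) : s \in pairings c (active c F) ->
    involutive s /\ forall e, e \notin active c F -> s e = e.
  rewrite inE => /forallP H; split=> e; have /and3P[/eqP ? _ /implyP] // := H e.
  by move=> /[apply] /eqP.
have [pK pT] := pairP _ _ _ _ pP; have [qK qT] := pairP _ _ _ _ qP.
apply: card_alternating => //.
- by apply/subsetP => e; rewrite inE => /andP[].
- by apply/subsetP => e; rewrite inE => /andP[].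
- by apply/subsetP => e; rewrite inE => /andP[].
- by move=> e; rewrite !inE => /andP[_ /eqP ->]; rewrite (negbTE vF) andbF.
Qed.

End BalancedSubsets.

(** * Log-concavity of degree-constrained generating functions *)

Section LogConcavity.
Local Open Scope ring_scope.
Variables (R : realType) (E U V : finType) (a : E -> U) (b : E -> V) (w : E -> R).
Hypothesis w_ge0 : forall e, 0 <= w e.

Definition has_degrees (FU : {set U}) (FV : {set V}) (du : U -> nat) (dv : V -> nat)
    (A : {set E}) :=
  [forall u in FU, deg a A u == du u] && [forall u in FV, deg b A u == dv u].

(** In the product of all [1 + w e * x (a e) * y (b e)], this is the coefficient of the monomial
    with exponents [du] on [FU] and [dv] on [FV], the other variables being set to 1. *)
Definition partition_function FU FV du dv : R :=
  \sum_(A : {set E} | has_degrees FU FV du dv A) \prod_(e in A) w e.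

Variables (FU : {set U}) (FV : {set V}) (du : U -> nat) (dv : V -> nat) (v : V).
Hypothesis vF : v \notin FV.

(** The coefficient of [t ^+ k] once the weights of all edges at [v] are multiplied by [t]. *)
Definition layer k : R :=
  \sum_(A : {set E} | has_degrees FU FV du dv A && (deg b A v == k)) \prod_(e in A) w e.

Lemma layer_ge0 k : 0 <= layer k.
Proof. by apply: sumr_ge0 => A _; apply: prodr_ge0. Qed.

Let layer_pair k A := has_degrees FU FV du dv A && (deg b A v == k).

(** The overlay determines the multiset union of the two sets, hence the product of their
    weights. *)
Let overlay (x : {set E} * {set E}) := (x.1 :&: x.2, symdiff x.1 x.2).

Let overlay_fibre x y I S := [set AB : {set E} * {set E} |
  (layer_pair x AB.1 && layer_pair y AB.2) && (overlay AB == (I, S))].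

Let prod_overlay (A B : {set E}) : (\prod_(e in A) w e) * (\prod_(e in B) w e) =
  (\prod_(e in A :&: B) w e) ^+ 2 * \prod_(e in symdiff A B) w e.
Proof.
rewrite (big_setID B) /= [X in _ * X](big_setID A) /= (setIC B A).
rewrite [X in _ = _ * X](big_setID A) /=.
have -> : symdiff A B :&: A = A :\: B.
  by apply/setP => e; rewrite inE in_symdiff !inE; case: (e \in A); case: (e \in B).
have -> : symdiff A B :\: A = B :\: A.
  by apply/setP => e; rewrite inE in_symdiff !inE; case: (e \in A); case: (e \in B).
by rewrite expr2 mulrACA.
Qed.

Let deg_overlay (W : finType) (c : E -> W) (A B : {set E}) u :
  (deg c A u = deg c (A :&: B) u + deg c (A :\: B) u)%N /\
  (deg c B u = deg c (A :&: B) u + deg c (B :\: A) u)%N /\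
  (deg c (symdiff A B) u = deg c (A :\: B) u + deg c (B :\: A) u)%N.
Proof.
split; first exact: degID; split; first by rewrite setIC; apply: degID.
rewrite (degID _ _ A); congr ((_ : nat) + _)%N; congr deg;
by apply/setP => e; rewrite inE in_symdiff !inE; case: (e \in A); case: (e \in B).
Qed.

(** Given the overlay, a pair [(A, B)] is recovered from [A :\: B]. As [A] and [B] have equal
    degrees on [FU] and [FV], this difference takes half of the degree of [S] there, so
    [card_balanced_subsets] compares the two fibres. *)
Let card_fibre x y (I S : {set E}) : (x.+2 <= y)%N ->
  (#|overlay_fibre x y I S| <= #|overlay_fibre x.+1 y.-1 I S|)%N.
Proof.
move=> xy; have [->|[[A0 B0]]] := set_0Vmem (overlay_fibre x y I S).
  by rewrite cards0.
rewrite inE /= => /andP[/andP[/andP[/andP[A0u A0v] /eqP A0x] /andP[/andP[B0u B0v] /eqP B0y]]].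
move=> /eqP[IE SE].
have IS e : e \in I -> e \notin S by rewrite -IE -SE in_symdiff !inE => /andP[-> ->].
have degFU u : u \in FU -> ((deg a I u).*2 + deg a S u = (du u).*2)%N.
  move=> uF; have /forall_inP/(_ u uF)/eqP := A0u; have /forall_inP/(_ u uF)/eqP := B0u.
  have [-> [-> +]] := deg_overlay a A0 B0 u; rewrite IE SE; lia.
have degFV u : u \in FV -> ((deg b I u).*2 + deg b S u = (dv u).*2)%N.
  move=> uF; have /forall_inP/(_ u uF)/eqP := A0v; have /forall_inP/(_ u uF)/eqP := B0v.
  have [-> [-> +]] := deg_overlay b A0 B0 u; rewrite IE SE; lia.
have [degA [degB degS]] := deg_overlay b A0 B0 v.
rewrite IE SE A0x B0y in degA degB degS.
(* This is the degree of [A :\: B] at [v]; the gap [x.+2 <= y] places it below the middle of the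
   degree of [S]. *)
pose k := (x - deg b I v)%N.
have kS : (k.*2.+2 <= deg b S v)%N by rewrite /k; lia.
apply: leq_trans (leq_trans (card_balanced_subsets a FU vF kS) _).
  pose f (AB : {set E} * {set E}) := AB.1 :\: AB.2.
  rewrite -(card_in_imset (f := f)); last first.
    move=> [A B] [A' B']; rewrite !inE => /andP[_ /eqP[/setP IA /setP SA]].
    move=> /andP[_ /eqP[/setP IA' /setP SA']] /setP fE.
    congr pair; apply/setP => e; have := fE e; have := SA e; have := SA' e;
    have := IA e; have := IA' e; rewrite /= !in_symdiff !inE => <- + <-;
    by do 4!case: (_ \in _).
  apply/subset_leq_card/subsetP => _ /imsetP[[A B] + ->]; rewrite /f inE /=.
  move=> /andP[/andP[/andP[/andP[Au Av] /eqP Ax] /andP[/andP[Bu Bv] /eqP By]] /eqP[IA SA]].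
  rewrite inE; apply/and4P; split.
  - by rewrite -SA subsetUl.
  - apply/forall_inP => u uF; have /forall_inP/(_ u uF)/eqP := Au.
    have /forall_inP/(_ u uF)/eqP := Bu; have [-> [-> +]] := deg_overlay a A B u.
    rewrite IA SA => ? ? ?; apply/eqP; lia.
  - apply/forall_inP => u uF; have /forall_inP/(_ u uF)/eqP := Av.
    have /forall_inP/(_ u uF)/eqP := Bv; have [-> [-> +]] := deg_overlay b A B u.
    rewrite IA SA => ? ? ?; apply/eqP; lia.
  - have [+ _] := deg_overlay b A B v; rewrite IA Ax /k => ->; apply/eqP; lia.
(* The inverse construction, now applied to sets of degree [k.+1] at [v]. *)
pose g (M : {set E}) := (I :|: M, I :|: (S :\: M)).
have gI (M : {set E}) : M \subset S -> (I :|: M) :&: (I :|: (S :\: M)) = I.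
  move=> /subsetP MS; apply/setP => e; have := MS e; have := IS e; rewrite !inE.
  by case: (e \in I); case: (e \in M); case: (e \in S) => //= ? ?; auto.
have gD (M : {set E}) : M \subset S -> (I :|: M) :\: (I :|: (S :\: M)) = M.
  move=> /subsetP MS; apply/setP => e; have := MS e; have := IS e; rewrite !inE.
  by case: (e \in I); case: (e \in M); case: (e \in S) => //= A1 A2; rewrite ?A2 //; have := A1 isT.
have gS (M : {set E}) : M \subset S -> symdiff (I :|: M) (I :|: (S :\: M)) = S.
  move=> /subsetP MS; apply/setP => e; have := MS e; have := IS e; rewrite in_symdiff !inE.
  by case: (e \in I); case: (e \in M); case: (e \in S) => //= A1 A2; rewrite ?A2 //; have := A1 isT.
rewrite -(card_in_imset (f := g)); last first.
  move=> M M'; rewrite !inE => /and4P[MS _ _ _] /and4P[MS' _ _ _] gE.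
  by rewrite -(gD M) // -(gD M') //; case: gE => -> ->.
apply/subset_leq_card/subsetP => _ /imsetP[M + ->]; rewrite inE.
move=> /and4P[MS /forall_inP hu /forall_inP hv /eqP Mv].
rewrite inE /= /overlay /= gI // gS // eqxx andbT.
have dg (W : finType) (c : E -> W) u : deg c (I :|: M) u = (deg c I u + deg c M u)%N /\
   (deg c (I :|: (S :\: M)) u + deg c M u = deg c I u + deg c S u)%N.
  have [-> [-> +]] := deg_overlay c (I :|: M) (I :|: (S :\: M)) u.
  rewrite gI // gD // gS // => ->; lia.
rewrite /layer_pair /has_degrees -!andbA; apply/and5P; split; last (apply/andP; split).
- apply/forall_inP => u uF; have [-> _] := dg _ a u.
  have := hu u uF; have := degFU u uF => ? ?; apply/eqP; lia.
- apply/forall_inP => u uF; have [-> _] := dg _ b u.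
  have := hv u uF; have := degFV u uF => ? ?; apply/eqP; lia.
- have [-> _] := dg _ b v; rewrite Mv /k; apply/eqP; lia.
- apply/forall_inP => u uF; have [_ +] := dg _ a u.
  have := hu u uF; have := degFU u uF => ? ? ?; apply/eqP; lia.
- apply/forall_inP => u uF; have [_ +] := dg _ b u.
  have := hv u uF; have := degFV u uF => ? ? ?; apply/eqP; lia.
- have [_ +] := dg _ b v; rewrite Mv /k => ?; apply/eqP; lia.
Qed.

(** Both products are sorted by overlay: the weights then agree term by term, and only the fibre
    sizes have to be compared. *)
Lemma layer_log_concave x y : (x.+2 <= y)%N ->
  layer x * layer y <= layer x.+1 * layer y.-1.
Proof.
move=> xy.
have expand x' y' : layer x' * layer y' =
    \sum_(IS : {set E} * {set E}) ((\prod_(e in IS.1) w e) ^+ 2 * \prod_(e in IS.2) w e)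
      *+ #|overlay_fibre x' y' IS.1 IS.2|.
  rewrite /layer big_distrlr /= pair_big /= (partition_big overlay predT) //=.
  apply: eq_bigr => -[I S] _ /=; rewrite -sumr_const.
  under [RHS]eq_bigl => AB do rewrite inE.
  apply: eq_bigr => -[A B] /= /andP[_ /eqP[<- <-]]; exact: prod_overlay.
rewrite !expand; apply: ler_sum => -[I S] _ /=; apply: ler_wpMn2l; last exact: card_fibre.
by apply: mulr_ge0; [apply: exprn_ge0 | ]; apply: prodr_ge0.
Qed.

End LogConcavity.

(** * Capacity *)

Local Open Scope ring_scope.

Section LogConcaveSequence.
Variables (R : realType) (a : nat -> R).
Hypothesis a_ge0 : forall k, 0 <= a k.
Hypothesis a_lc : forall x y, (x.+2 <= y)%N -> a x * a y <= a x.+1 * a y.-1.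

#[local] Hint Resolve a_ge0 : core.

(** Log-concavity moves [x] and [y] inwards without decreasing the product, until one of them
    reaches [c]. *)
Let no_internal_zero c x y : a c = 0 -> (x < c)%N -> (c < y)%N -> a x * a y = 0.
Proof.
move=> ac0; have [n] := ubnP (y - x); elim: n x y => // n IH x y ltn xc cy.
apply/eqP; rewrite eq_le mulr_ge0 // andbT; apply: le_trans (a_lc _) _; first lia.
have [->|nx] := eqVneq x.+1 c; first by rewrite ac0 mul0r.
have [->|ny] := eqVneq y.-1 c; first by rewrite ac0 mulr0.
by rewrite IH //; lia.
Qed.

(** Log-concavity leaves room for [t] between the ratios [a c.-1 / a c] and [a c / a c.+1]; the
    terms [a k * t ^+ k] then rise up to [c] and fall afterwards. *)
Let peak c : 0 < a c -> exists2 t, 0 < t & forall k, a k * t ^+ k <= a c * t ^+ c.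
Proof.
move=> ac; pose prev := if c is c'.+1 then a c' else 0.
have prev_ge0 : 0 <= prev by rewrite /prev; case: (c) => [|c'].
have lc1 : prev * a c.+1 <= a c * a c.
  rewrite /prev; case: (c) => [|c']; first by rewrite mul0r mulr_ge0.
  exact: (a_lc (ltnSn c'.+1)).
have [t [t0 tprev tnext]] : exists t, [/\ 0 < t, prev <= t * a c & t * a c.+1 <= a c].
  have [n0|n0] := eqVneq (a c.+1) 0.
    exists (prev / a c + 1); split; first by rewrite ltr_wpDl // divr_ge0.
      by rewrite mulrDl divfK ?gt_eqF // mul1r lerDl ltW.
    by rewrite n0 mulr0 ltW.
  have n1 : 0 < a c.+1 by rewrite lt_def n0 a_ge0.
  exists (a c / a c.+1); split; first exact: divr_gt0.
    by rewrite mulrAC ler_pdivlMr.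
  by rewrite divfK.
exists t => // k.
have up i : a (c + i)%N * t ^+ (c + i) <= a c * t ^+ c.
  elim: i => [|i IH]; first by rewrite addn0.
  apply: le_trans IH; rewrite addnS exprS mulrA; apply: ler_wpM2r; first exact/exprn_ge0/ltW.
  case: i => [|i]; first by rewrite addn0 mulrC.
  rewrite -(ler_pM2l ac).
  have := @a_lc c (c + i.+1).+1; rewrite /= => /(_ ltac:(lia)) H.
  apply: (@le_trans _ _ (t * (a c.+1 * a (c + i.+1)%N))).
    by rewrite mulrA [leRHS]mulrC ler_wpM2r // ltW.
  by rewrite mulrA ler_wpM2r.
have down i : (i <= c)%N -> a (c - i)%N * t ^+ (c - i) <= a c * t ^+ c.
  elim: i => [|i IH] ic; first by rewrite subn0.
  apply: le_trans (IH (ltnW ic)); have -> : (c - i)%N = (c - i.+1).+1 by lia.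
  set d := (c - i.+1)%N; rewrite exprS mulrA; apply: ler_wpM2r; first exact/exprn_ge0/ltW.
  have cd : (d.+1 <= c)%N by rewrite /d; lia.
  move: ac tprev; rewrite /prev; case: (c) cd => // c' cd ac tprev.
  have [->|ne] := eqVneq d c'; first by rewrite mulrC.
  rewrite -(ler_pM2r ac); apply: (@le_trans _ _ (a d.+1 * a c')).
    by have := @a_lc d c'.+1; apply; lia.
  by rewrite -mulrA ler_wpM2l.
have [kc|kc] := leqP c k; first by rewrite -(subnKC kc) up.
by rewrite -(subKn (ltnW kc)) down // leq_subr.
Qed.

(** If [a c] is positive, evaluate where the [c]-th of the [N.+1] terms is the largest. If it
    vanishes, the support lies on one side of [c], and letting [t] tend to 0 or to infinity gives
    [K <= 0]. *)
Lemma log_concave_coef N c K :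
  (forall t, 0 < t -> K * t ^+ c <= \sum_(k < N.+1) a k * t ^+ k) ->
  K <= N.+1%:R * a c.
Proof.
move=> HK; have := a_ge0 c; rewrite le_eqVlt => /predU1P[ac0|ac]; last first.
  have [t t0 tmax] := peak ac; rewrite -(ler_pM2r (exprn_gt0 c t0)).
  apply: le_trans (HK t t0) _.
  rewrite -[N.+1 in leRHS]card_ord -mulrA mulr_natl -sumr_const; exact: ler_sum.
rewrite -ac0 mulr0; pose B := \sum_(k < N.+1) a k.
have B0 : 0 <= B by apply: sumr_ge0.
have squeeze : (forall s, 0 < s -> s <= 1 -> K <= s * B) -> K <= 0.
  move=> H; rewrite leNgt; apply/negP => K0.
  have D0 : 0 < K + B + 1 by lra.
  (* This [s] lies in [(0, 1]] and satisfies [s * B < K]. *)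
  have := H (K / (K + B + 1)) (divr_gt0 K0 D0).
  rewrite ler_pdivrMr // mul1r => /(_ ltac:(lra)).
  rewrite mulrAC ler_pdivlMr // ler_pM2l //; lra.
have [/forall_inP lo|] := boolP [forall k : 'I_N.+1 in [pred k : 'I_N.+1 | (k < c)%N], a k == 0].
  apply: squeeze => s s0 s1; rewrite -(ler_pM2r (exprn_gt0 c s0)).
  apply: le_trans (HK s s0) _; rewrite mulrAC -exprS mulr_sumr; apply: ler_sum => k _.
  have [kc|kc|->] := ltngtP k c; last by rewrite -ac0 mul0r mulr0.
    by rewrite (eqP (lo k _)) ?mul0r ?mulr0 // inE.
  by rewrite mulrC ler_wpM2r // ler_wiXn2l // ltW.
rewrite negb_forall_in => /exists_inP[x]; rewrite inE => xc nx.
have hi k : (c < k)%N -> a k = 0.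
  move=> ck; have /eqP := no_internal_zero (esym ac0) xc ck.
  by rewrite mulf_eq0 (negbTE nx) => /eqP.
apply: squeeze => s s0 s1; have := HK s^-1; rewrite invr_gt0 => /(_ s0) H.
have sc := exprn_gt0 c s0.
have : K * s^-1 ^+ c * s ^+ c <= (\sum_(k < N.+1) a k * s^-1 ^+ k) * s ^+ c by rewrite ler_pM2r.
rewrite -mulrA -exprMn mulVf ?gt_eqF // expr1n mulr1 => /le_trans; apply.
rewrite mulr_suml mulr_sumr; apply: ler_sum => k _.
have [kc|kc|->] := ltngtP k c; last by rewrite -ac0 !mul0r mulr0.
  rewrite -mulrA [leRHS]mulrC ler_wpM2l // -(subnKC (ltnW kc)) exprD mulrA -exprMn.
  rewrite mulVf ?gt_eqF // expr1n mul1r -[leRHS]expr1 ler_wiXn2l // ?ltW //; lia.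
by rewrite hi // !mul0r mulr0.
Qed.

End LogConcaveSequence.

(** * Extracting one coefficient at a time from a capacity bound *)

Section Capacity.
Variable R : realType.

Definition scaled_weight (E U V : finType) (a : E -> U) (b : E -> V) (w : E -> R)
  (x : U -> R) (y : V -> R) e := w e * x (a e) * y (b e).

(** The variables indexed by [FU] and [FV] have already been extracted; they survive on both sides
    only as the same monomial factor. *)
Definition capacity_ge (E U V : finType) (a : E -> U) (b : E -> V) (w : E -> R)
    (du : U -> nat) (dv : V -> nat) (FU : {set U}) (FV : {set V}) (K : R) :=
  forall x y, (forall u, 0 < x u) -> (forall v, 0 < y v) ->
  K * ((\prod_u x u ^+ du u) * (\prod_v y v ^+ dv v)) <=
  partition_function a b (scaled_weight a b w x y) FU FV du dv.

Lemma partition_functionC (E U V : finType) (a : E -> U) (b : E -> V) (w : E -> R) FU FV du dv :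
  partition_function a b w FU FV du dv = partition_function b a w FV FU dv du.
Proof. by apply: eq_bigl => A; rewrite /has_degrees andbC. Qed.

Lemma capacity_geC (E U V : finType) (a : E -> U) (b : E -> V) (w : E -> R) du dv FU FV K :
  capacity_ge a b w du dv FU FV K -> capacity_ge b a w dv du FV FU K.
Proof.
move=> H x y x0 y0; rewrite partition_functionC.
have := H y x y0 x0; rewrite [X in K * X]mulrC => /le_trans; apply.
rewrite le_eqVlt; apply/orP; left; apply/eqP; apply: eq_bigr => A _; apply: eq_bigr => e _.
by rewrite /scaled_weight mulrAC.
Qed.

Section Step.
Variables (E U V : finType) (a : E -> U) (b : E -> V) (w : E -> R).
Variables (du : U -> nat) (dv : V -> nat) (N : nat).
Hypothesis w_ge0 : forall e, 0 <= w e.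
Hypothesis degN : forall v, (deg b setT v <= N)%N.

Let degb (A : {set E}) v : (deg b A v < N.+1)%N.
Proof.
rewrite ltnS; apply: leq_trans (degN v); apply/subset_leq_card/subsetP => e.
by rewrite !inE => /andP[].
Qed.

Let upd (y : V -> R) v t v' := if v' == v then t else y v'.

Let prod_upd (y : V -> R) v t : 
  \prod_v' upd y v t v' ^+ dv v' = t ^+ dv v * \prod_(v' | v' != v) y v' ^+ dv v'.
Proof.
rewrite (bigD1 v) //= /upd eqxx; congr (_ * _).
by apply: eq_bigr => v' /negbTE ->.
Qed.

Let weight_upd x y v t (A : {set E}) :
  \prod_(e in A) scaled_weight a b w x (upd y v t) e =
  (\prod_(e in A) scaled_weight a b w x (upd y v 1) e) * t ^+ deg b A v.
Proof.
have -> : t ^+ deg b A v = \prod_(e in A) (if b e == v then t else 1).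
  rewrite /deg -big_mkcondr /= -prodr_const; apply: eq_bigl => e; by rewrite inE.
rewrite -big_split /=; apply: eq_bigr => e _; rewrite /scaled_weight /upd.
by case: eqP => _; rewrite mulr1.
Qed.

(** As a polynomial in [y v], the right side has degree at most [N] and log-concave coefficients, so
    [log_concave_coef] extracts one of them at the cost of [N.+1]. *)
Lemma capacity_ge_step (FU : {set U}) (FV : {set V}) v K : v \notin FV ->
  capacity_ge a b w du dv FU FV K ->
  capacity_ge a b w du dv FU (v |: FV) (K / N.+1%:R).
Proof.
move=> vF HK x y x0 y0.
pose w1 := scaled_weight a b w x (upd y v 1).
have w1_ge0 e : 0 <= w1 e.
  by rewrite /w1 /scaled_weight /upd !mulr_ge0 // ?ltW //; case: ifP.
pose f := layer a b w1 FU FV du dv v.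
pose K' := K * ((\prod_u x u ^+ du u) * \prod_(v' | v' != v) y v' ^+ dv v').
have K'f : K' <= N.+1%:R * f (dv v).
  apply: log_concave_coef => [k|p q|t t0]; first exact: layer_ge0.
    exact: layer_log_concave.
  have yt v' : 0 < upd y v t v' by rewrite /upd; case: ifP.
  have := HK x _ x0 yt; rewrite prod_upd.
  have -> : K' * t ^+ dv v = K * ((\prod_u x u ^+ du u) *
      (t ^+ dv v * \prod_(v' | v' != v) y v' ^+ dv v')) by rewrite /K'; ring.
  move=> /le_trans; apply; rewrite le_eqVlt; apply/orP; left; apply/eqP.
  rewrite /partition_function (partition_big (fun A => Ordinal (degb A v)) predT) //=.
  apply: eq_bigr => k _; rewrite mulr_suml; apply: eq_big => A.
    by rewrite -val_eqE.
  by move=> /andP[_ /eqP <-]; rewrite weight_upd.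
have -> : partition_function a b (scaled_weight a b w x y) FU (v |: FV) du dv =
    f (dv v) * y v ^+ dv v.
  rewrite /partition_function /f /layer mulr_suml; apply: eq_big => A.
    rewrite /has_degrees -andbA; congr andb.
    apply/forall_inP/andP => [H|[/forall_inP H /eqP Hv] v'].
      split; last by apply: H; rewrite !inE eqxx.
      by apply/forall_inP => v' v'F; apply: H; rewrite !inE v'F orbT.
    by rewrite !inE => /predU1P[->|/H //]; apply/eqP.
  rewrite /has_degrees => /andP[_ /forall_inP/(_ v)]; rewrite !inE eqxx => /(_ isT)/eqP <-.
  rewrite -weight_upd; apply: eq_bigr => e _; rewrite /scaled_weight /upd.
  by case: eqP => [->|].
have -> : K / N.+1%:R * (\prod_u x u ^+ du u * \prod_v0 y v0 ^+ dv v0) =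
    K' / N.+1%:R * y v ^+ dv v.
  by rewrite [\prod_v0 y v0 ^+ _](bigD1 v) //= /K'; ring.
apply: ler_wpM2r; first exact/exprn_ge0/ltW.
by rewrite ler_pdivrMr ?ltr0n // mulrC.
Qed.

Lemma capacity_ge_all FU K : capacity_ge a b w du dv FU set0 K ->
  capacity_ge a b w du dv FU setT (K / N.+1%:R ^+ #|V|).
Proof.
move=> HK.
suff H n : (n <= #|V|)%N ->
    exists2 F : {set V}, #|F| = n & capacity_ge a b w du dv FU F (K / N.+1%:R ^+ n).
  have [F Fc] := H _ (leqnn _); suff -> : F = setT by [].
  by apply/eqP; rewrite eqEcard subsetT cardsT Fc leqnn.
elim: n => [|n IH] nV; first by exists set0; rewrite ?cards0 // expr0 divr1.
have [F Fn HF] := IH (ltnW nV).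
have /subsetPn[v _ vF] : ~~ ([set: V] \subset F).
  by apply/negP => /subset_leq_card; rewrite cardsT Fn leqNgt nV.
exists (v |: F); first by rewrite cardsU1 vF Fn.
by rewrite exprSr invfM mulrA; apply: capacity_ge_step.
Qed.

End Step.

Lemma prod_1D_subsets (E : finType) (w : E -> R) :
  \prod_e (1 + w e) = \sum_(A : {set E}) \prod_(e in A) w e.
Proof.
under eq_bigr do rewrite addrC.
rewrite bigA_distr; apply: eq_bigr => A _; rewrite [RHS]big_mkcond /=.
by apply: eq_bigr.
Qed.

(** With no degree constraint the partition function is the full product. The variables of [V] are
    extracted first, then those of [U] after swapping the sides, and finally all variables are set
    to 1. *)
Theorem capacity_lower_bound (E U V : finType) (a : E -> U) (b : E -> V) (w : E -> R)
    (du : U -> nat) (dv : V -> nat) (NU NV : nat) (K : R) :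
  (forall e, 0 <= w e) ->
  (forall u, deg a setT u <= NU)%N -> (forall v, deg b setT v <= NV)%N ->
  (forall x y, (forall u, 0 < x u) -> (forall v, 0 < y v) ->
     K * ((\prod_u x u ^+ du u) * (\prod_v y v ^+ dv v)) <=
     \prod_e (1 + w e * x (a e) * y (b e))) ->
  K <= NU.+1%:R ^+ #|U| * NV.+1%:R ^+ #|V| *
       partition_function a b w setT setT du dv.
Proof.
move=> w0 dU dV HK.
have H0 : capacity_ge a b w du dv set0 set0 K.
  move=> x y x0 y0; apply: le_trans (HK x y x0 y0) _.
  rewrite (prod_1D_subsets (fun e => w e * x (a e) * y (b e))) le_eqVlt.
  apply/orP; left; apply/eqP; apply: eq_bigl => A.
  by apply/esym/andP; split; apply/forall_inP => u; rewrite inE.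
have := capacity_ge_all w0 dU (capacity_geC (capacity_ge_all w0 dV H0)).
move=> /(_ (fun=> 1) (fun=> 1) (fun=> ltr01) (fun=> ltr01)).
rewrite -partition_functionC !big1 ?mulr1; try by move=> *; rewrite expr1n.
rewrite -mulrA -invfM ler_pdivrMr ?mulr_gt0 ?exprn_gt0 ?ltr0n //.
rewrite mulrC [X in X * _]mulrC => /le_trans; apply; rewrite le_eqVlt; apply/orP; left; apply/eqP.
congr (_ * _); apply: eq_bigr => A _; apply: eq_bigr => e _.
by rewrite /scaled_weight !mulr1.
Qed.

End Capacity.

(** * Entropy and its maximizer *)

Section BinaryEntropy.
Variable R : realType.
Implicit Types z u s t d : R.

Definition bin_entropy z := z * ln (1 / z) + (1 - z) * ln (1 / (1 - z)).

Lemma ln_le_sub1 z : 0 < z -> ln z <= z - 1.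
Proof. by move=> z0; have := @le_ln1Dx R (z - 1); rewrite subrKC; apply; lra. Qed.

Lemma bin_entropyE z : 0 < z < 1 -> bin_entropy z = - (z * ln z) - (1 - z) * ln (1 - z).
Proof.
move=> /andP[z0 z1]; have z1' : 0 < 1 - z by lra.
by rewrite /bin_entropy !div1r !lnV ?posrE // !mulrN.
Qed.

Lemma bin_entropy0 : bin_entropy 0 = 0.
Proof. by rewrite /bin_entropy mul0r subr0 divr1 ln1 mulr0 addr0. Qed.

Lemma bin_entropyC z : bin_entropy (1 - z) = bin_entropy z.
Proof. by rewrite /bin_entropy subKr addrC. Qed.

Lemma bin_entropy_ge0 z : 0 <= z <= 1 -> 0 <= bin_entropy z.
Proof.
have ge0 u : 0 <= u <= 1 -> 0 <= u * ln (1 / u).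
  move=> /andP[]; rewrite le_eqVlt => /predU1P[<- _|u0 u1]; first by rewrite mul0r.
  by rewrite div1r lnV ?posrE // mulr_ge0 ?oppr_ge0 ?ln_le0 // ltW.
by move=> z01; rewrite addr_ge0 // ge0 //; lra.
Qed.

(* The error term is the chi-square upper bound for the Kullback-Leibler divergence. *)
Lemma bin_entropy_expand z d t : 0 < z < 1 -> 0 < z + t * d < 1 ->
  bin_entropy z + t * (d * (ln (1 - z) - ln z)) - t ^+ 2 * (d ^+ 2 / (z * (1 - z))) <=
  bin_entropy (z + t * d).
Proof.
move=> z01 u01; rewrite !bin_entropyE //.
set u := z + t * d in u01 *; have ud : t * d = u - z by rewrite /u; ring.
case/andP: z01 => z0 z1; case/andP: u01 => u0 u1.
have z1' : 0 < 1 - z by lra.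
have u1' : 0 < 1 - u by lra.
have H1 := ler_wpM2l (ltW u0) (ln_le_sub1 (divr_gt0 u0 z0)).
have H2 := ler_wpM2l (ltW u1') (ln_le_sub1 (divr_gt0 u1' z1')).
rewrite ln_div ?posrE // in H1; rewrite ln_div ?posrE // in H2.
have chi : u * (u / z - 1) + (1 - u) * ((1 - u) / (1 - z) - 1) =
    t ^+ 2 * (d ^+ 2 / (z * (1 - z))).
  by rewrite mulrA -exprMn ud; field; rewrite !gt_eqF.
rewrite -chi [t * (d * _)]mulrA ud.
move: H1 H2; set L1 := ln u; set L2 := ln z; set L3 := ln (1 - u); set L4 := ln (1 - z).
move: (u / z) ((1 - u) / (1 - z)) => q1 q2; lra.
Qed.

(** A quantitative form of the infinite slope at 0; the nonnegative terms in [ln s] and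
    [ln (1 - t * s)] are dropped. *)
Lemma bin_entropy_near0 t s : 0 < t < 1 -> 0 < s < 1 ->
  t * (s * ln (1 / t)) <= bin_entropy (t * s).
Proof.
move=> /andP[t0 t1] /andP[s0 s1].
have ts0 : 0 < t * s by rewrite mulr_gt0.
have ts1 : t * s < 1 by rewrite mulr_ilt1 // ltW.
rewrite bin_entropyE ?ts0 // div1r lnV ?posrE // lnM ?posrE //.
have := ln_le0 (ltW s1); have : ln (1 - t * s) <= 0 by apply: ln_le0; lra.
move: (ln (1 - t * s)) (ln t) (ln s) => l1 l2 l3 h1 h2.
have : 0 <= (t * s) * - l3 by rewrite mulr_ge0 ?oppr_ge0 // ltW.
have : 0 <= (1 - t * s) * - l1 by rewrite mulr_ge0 ?oppr_ge0 // subr_ge0 ltW.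
rewrite mulrDr; lra.
Qed.

(** Weighted AM-GM for [s / z] and [1 / (1 - z)] with weights [z] and [1 - z]. Dividing both by
    [1 + s] makes the two linear bounds on [ln] cancel on average. *)
Lemma bin_entropy_dual z s : 0 < z < 1 -> 0 < s ->
  bin_entropy z + z * ln s <= ln (1 + s).
Proof.
move=> z01 s0; rewrite bin_entropyE //; case/andP: z01 => z0 z1.
have z1' : 0 < 1 - z by lra.
have s1 : 0 < 1 + s by lra.
have H1 := ler_wpM2l (ltW z0) (ln_le_sub1 (divr_gt0 s0 (mulr_gt0 z0 s1))).
have H2 := ler_wpM2l (ltW z1') (ln_le_sub1 (divr_gt0 ltr01 (mulr_gt0 z1' s1))).
rewrite ln_div ?posrE ?mulr_gt0 // lnM ?posrE // in H1.
rewrite ln_div ?posrE ?mulr_gt0 // lnM ?posrE // ln1 in H2.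
have E : z * (s / (z * (1 + s)) - 1) + (1 - z) * (1 / ((1 - z) * (1 + s)) - 1) = 0.
  by field; rewrite !gt_eqF.
move: H1 H2 E; move: (ln s) (ln z) (ln (1 - z)) (ln (1 + s)) => l1 l2 l3 l4.
move: (s / _) (1 / _) => q1 q2; lra.
Qed.

(** From [expR (- t) >= 1 - t] one gets [expR t <= 1 / (1 - t)], which is bounded by the quadratic
    on this range. *)
Lemma expR_le_quadratic t : `|t| <= 2^-1 -> expR t <= 1 + t + 2 * t ^+ 2.
Proof.
rewrite ler_norml => /andP[t1 t2].
have t0 : 0 < 1 - t by lra.
have : (expR t)^-1 >= 1 - t by rewrite -expRN; apply: expR_ge1Dx.
rewrite -[X in X <= _]invrK lef_pV2 ?posrE ?invr_gt0 ?expR_gt0 // => /le_trans; apply.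
rewrite invf_ple ?posrE //; last by nra.
rewrite -div1r ler_pdivrMr; nra.
Qed.

End BinaryEntropy.

(** * Interiority and first-order optimality of the maximizer *)

Section Optimality.
Variables (R : realType) (m n : nat) (r : 'I_m -> nat) (c : 'I_n -> nat) (W : 'M[bool]_(m, n)).
Implicit Types X Y Z : 'M[R]_(m, n).

Lemma polytope_segment X Z t : polytope r c W X -> polytope r c W Z -> 0 <= t <= 1 ->
  polytope r c W (Z + t *: (X - Z)).
Proof.
move=> [Xr Xc X01 XW] [Zr Zc Z01 ZW] /andP[t0 t1]; split.
- move=> i; under eq_bigr do rewrite !mxE.
  by rewrite big_split /= -mulr_sumr big_split /= sumrN Xr Zr subrr mulr0 addr0.
- move=> j; under eq_bigr do rewrite !mxE.
  by rewrite big_split /= -mulr_sumr big_split /= sumrN Xc Zc subrr mulr0 addr0.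
- move=> i j; rewrite !mxE; have /andP[? ?] := X01 i j; have /andP[? ?] := Z01 i j.
  apply/andP; split; nra.
- by move=> i j Wij; rewrite !mxE XW // ZW // subrr mulr0 addr0.
Qed.

(** Moving from [Z] towards [Y] by [t] would gain order [t * ln (1 / t)] at an allowed boundary
    entry, while the loss over all entries is at most linear in [t]. *)
Lemma maximizer_interior Y Z : polytope r c W Y ->
  (forall i j, W i j -> 0 < Y i j < 1) ->
  is_maximizer (polytope r c W) (@entropy R m n) Z ->
  forall i j, W i j -> 0 < Z i j < 1.
Proof.
move=> PY Y01 [PZ maxZ] i0 j0 W0; apply/negPn/negP => nZ0.
have [_ _ Z01 ZW] := PZ; have [_ _ _ YW] := PY.
(* For an interior entry this bounds the loss per unit of [t]; an entry at 0 or 1 loses nothing, and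
   only [0 <= C i j] matters there. *)
pose C i j := `|(Y i j - Z i j) * (ln (1 - Z i j) - ln (Z i j))| +
  `|(Y i j - Z i j) ^+ 2 / (Z i j * (1 - Z i j))|.
have C0 i j : 0 <= C i j by rewrite addr_ge0.
pose s := `|Y i0 j0 - Z i0 j0|.
have bd i j : ~~ (0 < Z i j < 1) -> Z i j = 0 \/ Z i j = 1.
  move=> nZ; have /andP[z0 z1] := Z01 i j; have [->|zn0] := eqVneq (Z i j) 0; first by left.
  have [->|zn1] := eqVneq (Z i j) 1; first by right.
  by case/negP: nZ; rewrite !lt_neqAle eq_sym zn0 z0 zn1 z1.
have s01 : 0 < s < 1.
  rewrite /s; have /andP[? ?] := Y01 _ _ W0; case: (bd _ _ nZ0) => ->.
    by rewrite subr0 ger0_norm; lra.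
  by rewrite distrC ger0_norm; lra.
pose CC := \sum_i \sum_j C i j.
have small t : 0 < t < 1 -> s * ln (1 / t) <= CC.
  move=> t01; have /andP[t0 t1] := t01.
  have PX : polytope r c W (Z + t *: (Y - Z)) by apply: polytope_segment => //; lra.
  have [_ _ X01 _] := PX.
  have := maxZ _ PX; rewrite /entropy -/(bin_entropy _) => H.
  have ent i j : bin_entropy (Z i j) - t * C i j +
      (if (i == i0) && (j == j0) then t * (s * ln (1 / t)) else 0) <=
      bin_entropy ((Z + t *: (Y - Z)) i j).
    have := X01 i j; rewrite !mxE => X01ij.
    case: ifPn => [/andP[/eqP-> /eqP->]|_].
      have ent0 : bin_entropy (Z i0 j0) = 0.
        by case: (bd _ _ nZ0) => ->; rewrite -?(bin_entropyC 1) ?subrr bin_entropy0.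
      have := bin_entropy_near0 t01 s01.
      have -> : bin_entropy (Z i0 j0 + t * (Y i0 j0 - Z i0 j0)) = bin_entropy (t * s).
        rewrite /s; have /andP[? ?] := Y01 _ _ W0; case: (bd _ _ nZ0) => ->.
          by rewrite subr0 add0r ger0_norm // ltW.
        rewrite distrC ger0_norm; last lra.
        by rewrite -bin_entropyC; congr bin_entropy; ring.
      rewrite ent0; have := mulr_ge0 (ltW t0) (C0 i0 j0); lra.
    rewrite addr0; have := mulr_ge0 (ltW t0) (C0 i j) => tC.
    have [z01|nz] := boolP (0 < Z i j < 1); last first.
      have -> : bin_entropy (Z i j) = 0.
        by case: (bd _ _ nz) => ->; rewrite -?(bin_entropyC 1) ?subrr bin_entropy0.
      by have := bin_entropy_ge0 X01ij; lra.
    have u01 : 0 < Z i j + t * (Y i j - Z i j) < 1.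
      have Wij : W i j by apply/negPn/negP => /negbTE/ZW Z0; move: z01; rewrite Z0 ltxx.
      have /andP[? ?] := Y01 _ _ Wij; have /andP[? ?] := z01; apply/andP; split; nra.
    apply: le_trans (bin_entropy_expand z01 u01).
    rewrite -[leRHS]addrA lerD2l /C mulrDr opprD.
    have le1 (x : R) : - `|x| <= x by rewrite lerNl -normrN ler_norm.
    apply: lerD; first by rewrite -mulrN ler_wpM2l // ltW.
    rewrite lerN2.
    apply: (@le_trans _ _ (t ^+ 2 * `|(Y i j - Z i j) ^+ 2 / (Z i j * (1 - Z i j))|)).
      by rewrite ler_wpM2l ?sqr_ge0 // ler_norm.
    by rewrite ler_wpM2r // expr2 ler_piMl // ltW.
  have := le_trans (ler_sum _ (fun i _ => ler_sum _ (fun j _ => ent i j))) H.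
  under eq_bigr => i _ do rewrite big_split /= sumrB -mulr_sumr.
  rewrite big_split /= sumrB -mulr_sumr -/CC.
  have -> : \sum_i \sum_j (if (i == i0) && (j == j0) then t * (s * ln (1 / t)) else 0) =
      t * (s * ln (1 / t)).
    rewrite (bigD1 i0) //= (bigD1 j0) //= !eqxx /= !big1 ?addr0 //.
      by move=> i /negbTE ->; rewrite big1.
    by move=> j /negbTE ->.
  by rewrite -addrA gerDl addrC subr_le0 ler_pM2l.
have /andP[s0 s1] := s01.
have CC0 : 0 <= CC by apply: sumr_ge0 => i _; apply: sumr_ge0.
(* For this [t] the gain [s * ln (1 / t)] equals [CC + 1]. *)
have := small (expR (- ((CC + 1) / s))); rewrite expR_gt0 expR_lt1 oppr_lt0 divr_gt0 //; last lra.
rewrite div1r -expRN opprK expRK mulrC divfK ?gt_eqF // => /(_ isT); lra.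
Qed.

(** The sum is the derivative of the entropy at [Z] towards [X]; it is at most [t * Q] for every
    small [t], by the quadratic error in [bin_entropy_expand]. *)
Lemma maximizer_first_order X Z :
  is_maximizer (polytope r c W) (@entropy R m n) Z ->
  (forall i j, W i j -> 0 < Z i j < 1) -> polytope r c W X ->
  \sum_i \sum_j (X i j - Z i j) * (ln (1 - Z i j) - ln (Z i j)) <= 0.
Proof.
move=> [PZ maxZ] Zint PX; have [_ _ Z01 ZW] := PZ; have [_ _ X01 XW] := PX.
pose q i j := (X i j - Z i j) ^+ 2 / (Z i j * (1 - Z i j)).
pose Q := \sum_i \sum_j q i j.
set G := \sum_i _.
have small t : 0 < t < 1 -> G <= t * Q.
  move=> /andP[t0 t1].
  have PU : polytope r c W (Z + t *: (X - Z)) by apply: polytope_segment => //; lra.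
  have := maxZ _ PU; rewrite /entropy -/(bin_entropy _) => H.
  have ent i j : bin_entropy (Z i j) + t * ((X i j - Z i j) * (ln (1 - Z i j) - ln (Z i j)))
      - t ^+ 2 * q i j <= bin_entropy ((Z + t *: (X - Z)) i j).
    rewrite !mxE; have [Wij|/negbTE Wij] := boolP (W i j); last first.
      by rewrite /q XW // ZW // !(subrr, mul0r, mulr0, addr0, expr0n) subr0.
    have z01 := Zint _ _ Wij; apply: bin_entropy_expand => //.
    have /andP[? ?] := X01 i j; have /andP[? ?] := z01; apply/andP; split; nra.
  have := le_trans (ler_sum _ (fun i _ => ler_sum _ (fun j _ => ent i j))) H.
  under eq_bigr => i _ do rewrite sumrB big_split /= -!mulr_sumr.
  rewrite sumrB big_split /= -!mulr_sumr -/G -/Q.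
  rewrite -addrA gerDl subr_le0 expr2 -mulrA ler_pM2l //.
rewrite leNgt; apply/negP => G0.
have Q0 : 0 <= Q.
  apply: sumr_ge0 => i _; apply: sumr_ge0 => j _; rewrite /q divr_ge0 ?sqr_ge0 //.
  by have /andP[? ?] := Z01 i j; rewrite mulr_ge0 // subr_ge0.
have D0 : 0 < G + Q + 1 by lra.
have := small (G / (G + Q + 1)); rewrite divr_gt0 // ltr_pdivrMr // mul1r.
move=> /(_ ltac:(lra)); rewrite mulrAC ler_pdivlMr // ler_pM2l //; lra.
Qed.

End Optimality.

(** * Counting and concentration *)

Section Supports.
Variables (m n : nat).
Implicit Types (D : 'M[bool]_(m, n)) (A : {set 'I_m * 'I_n}).

Definition support_set D : {set 'I_m * 'I_n} := [set p | D p.1 p.2]%SET.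

Definition indicator_mx A : 'M[bool]_(m, n) := \matrix_(i, j) ((i, j) \in A).

Lemma support_setK : cancel support_set indicator_mx.
Proof. by move=> D; apply/matrixP => i j; rewrite mxE inE. Qed.

Lemma indicator_mxK : cancel indicator_mx support_set.
Proof. by move=> A; apply/setP => -[i j]; rewrite inE mxE. Qed.

Lemma support_set_bij : bijective support_set.
Proof. by exists indicator_mx; [exact: support_setK | exact: indicator_mxK]. Qed.

Lemma indicator_mx_bij : bijective indicator_mx.
Proof. by exists support_set; [exact: indicator_mxK | exact: support_setK]. Qed.

Lemma deg_support_row D i : deg fst (support_set D) i = (\sum_j D i j)%N.
Proof.
rewrite /deg -sum1_card.
rewrite (eq_bigl (fun e : 'I_m * 'I_n => (e.1 == i) && D e.1 e.2)); last first.
  by move=> e; rewrite !inE andbC.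
rewrite -(pair_big_dep (pred1 i) (fun i j => D i j) (fun _ _ => 1%N)) /= big_pred1_eq.
by rewrite big_mkcond; apply: eq_bigr => j _; case: (D i j).
Qed.

Lemma deg_support_col D j : deg snd (support_set D) j = (\sum_i D i j)%N.
Proof.
rewrite /deg -sum1_card.
rewrite (eq_bigl (fun e : 'I_m * 'I_n => (e.2 == j) && D e.1 e.2)); last first.
  by move=> e; rewrite !inE andbC.
rewrite -(pair_big_dep predT (fun i j' => (j' == j) && D i j') (fun _ _ => 1%N)) /=.
apply: eq_bigr => i _; rewrite big_mkcondr /= big_pred1_eq.
by case: (D i j).
Qed.

Lemma deg_fst_setT (i : 'I_m) : deg (@fst 'I_m 'I_n) setT i = n.
Proof.
have -> : setT = support_set (const_mx true) by apply/setP => p; rewrite !inE mxE.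
by rewrite deg_support_row; under eq_bigr do rewrite mxE; rewrite sum_nat_const card_ord muln1.
Qed.

Lemma deg_snd_setT (j : 'I_n) : deg (@snd 'I_m 'I_n) setT j = m.
Proof.
have -> : setT = support_set (const_mx true) by apply/setP => p; rewrite !inE mxE.
by rewrite deg_support_col; under eq_bigr do rewrite mxE; rewrite sum_nat_const card_ord muln1.
Qed.

Variables (R : realType) (r : 'I_m -> nat) (c : 'I_n -> nat) (W : 'M[bool]_(m, n)).

Lemma partition_function_zero_one :
  partition_function fst snd (fun e => (W e.1 e.2)%:R : R) setT setT r c =
  #|zero_one_matrices r c W|%:R.
Proof.
rewrite /partition_function (reindex support_set) /=; last exact/onW_bij/support_set_bij.
rewrite -sum1_card natr_sum big_mkcond [RHS]big_mkcond /=; apply: eq_bigr => D _.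
rewrite inE /has_degrees andbA.
have -> : [forall u in setT, deg fst (support_set D) u == r u] =
    [forall i, (\sum_j D i j)%N == r i].
  by apply/forall_inP/forallP => H i; have := H i; rewrite ?inE deg_support_row //; apply.
have -> : [forall u in setT, deg snd (support_set D) u == c u] =
    [forall j, (\sum_i D i j)%N == c j].
  by apply/forall_inP/forallP => H i; have := H i; rewrite ?inE deg_support_col //; apply.
case: (_ && _) => //=; case: ifPn => [/forallP H|].
  rewrite big1 // => -[i j]; rewrite inE /= => Dij.
  by have /forallP/(_ j)/implyP := H i; case: (W i j) => //= /(_ isT); rewrite Dij.
rewrite negb_forall => /existsP[i]; rewrite negb_forall => /existsP[j].
rewrite negb_imply negbK => /andP[nW Dij].
by rewrite (bigD1 (i, j)) ?inE //= (negbTE nW) mul0r.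
Qed.

(** Apply [bin_entropy_dual] with [s = x i * y j] at each allowed entry; the row and column sums of
    [Z] turn the weights into the exponents [r] and [c]. *)
Lemma expR_entropy_le_card (Z : 'M[R]_(m, n)) : polytope r c W Z ->
  (forall i j, W i j -> 0 < Z i j < 1) ->
  expR (entropy Z) <= n.+1%:R ^+ m * m.+1%:R ^+ n * #|zero_one_matrices r c W|%:R.
Proof.
move=> [Zr Zc _ ZW] Zint; rewrite -partition_function_zero_one.
have := @capacity_lower_bound R ('I_m * 'I_n)%type 'I_m 'I_n fst snd
  (fun e => (W e.1 e.2)%:R) r c n m (expR (entropy Z)).
rewrite !card_ord; apply => [e|i|j|x y x0 y0]; rewrite ?ler0n ?deg_fst_setT ?deg_snd_setT //.
have prodE (k : nat) (z : 'I_k -> R) (d : 'I_k -> nat) : (forall i, 0 < z i) ->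
    \prod_i z i ^+ d i = expR (\sum_i (d i)%:R * ln (z i)).
  by move=> z0; rewrite expR_sum; apply: eq_bigr => i _; rewrite expRM_natl lnK ?posrE.
rewrite !prodE // -!expRD -(pair_bigA _ (fun i j => 1 + (W i j)%:R * x i * y j)) /=.
have -> : entropy Z + (\sum_i (r i)%:R * ln (x i) + \sum_i (c i)%:R * ln (y i)) =
    \sum_i \sum_j (bin_entropy (Z i j) + (Z i j * ln (x i) + Z i j * ln (y j))).
  have -> : \sum_i (r i)%:R * ln (x i) = \sum_i \sum_j Z i j * ln (x i).
    by apply: eq_bigr => i _; rewrite -mulr_suml Zr.
  have -> : \sum_j (c j)%:R * ln (y j) = \sum_i \sum_j Z i j * ln (y j).
    by rewrite exchange_big /=; apply: eq_bigr => j _; rewrite -mulr_suml Zc.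
  rewrite /entropy -!big_split /=; apply: eq_bigr => i _.
  by rewrite -!big_split /=.
rewrite expR_sum; apply: ler_prod => i _; rewrite expR_ge0 expR_sum /=.
apply: ler_prod => j _; rewrite expR_ge0 /=.
have [Wij|/negbTE Wij] := boolP (W i j); last first.
  by rewrite ZW // bin_entropy0 !mul0r !addr0 expR0.
have s0 : 0 < x i * y j by rewrite mulr_gt0.
rewrite mul1r -[leRHS]lnK ?posrE ?addr_gt0 // ler_expR -mulrDr -lnM ?posrE //.
by apply: bin_entropy_dual => //; apply: Zint.
Qed.

End Supports.

(** * Comparison with independent Bernoulli entries *)

Section Concentration.
Variables (R : realType) (m n : nat) (r : 'I_m -> nat) (c : 'I_n -> nat) (W : 'M[bool]_(m, n)).
Variable (Z : 'M[R]_(m, n)).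
Hypothesis maxZ : is_maximizer (polytope r c W) (@entropy R m n) Z.
Hypothesis Zint : forall i j, W i j -> 0 < Z i j < 1.

Definition bernoulli_weight (D : 'M[bool]_(m, n)) : R :=
  \prod_(p : 'I_m * 'I_n) (if D p.1 p.2 then Z p.1 p.2 else 1 - Z p.1 p.2).

Lemma real_mx_polytope D : D \in zero_one_matrices r c W ->
  polytope r c W (real_mx R D).
Proof.
rewrite inE => /and3P[/forallP Dr /forallP Dc /forallP DW]; split.
- by move=> i; under eq_bigr do rewrite mxE; rewrite -natr_sum (eqP (Dr i)).
- by move=> j; under eq_bigr do rewrite mxE; rewrite -natr_sum (eqP (Dc j)).
- by move=> i j; rewrite mxE; case: (D i j); rewrite ?lexx ?ler01.
- move=> i j Wij; rewrite mxE; have /forallP/(_ j) := DW i.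
  by rewrite Wij /=; case: (D i j).
Qed.

(* For the maximizer equality holds, but the inequality only needs the
   first-order condition in the feasible direction of [D]. *)
Lemma bernoulli_weight_ge D : D \in zero_one_matrices r c W ->
  expR (- entropy Z) <= bernoulli_weight D.
Proof.
move=> DS; have PD := real_mx_polytope DS.
have FO := maximizer_first_order maxZ Zint PD.
have [_ _ _ DW] := PD; have [[_ _ _ ZW] _] := maxZ.
pose l i j := if D i j then ln (Z i j) else ln (1 - Z i j).
have -> : bernoulli_weight D = expR (\sum_i \sum_j l i j).
  rewrite expR_sum; under [RHS]eq_bigr do rewrite expR_sum.
  rewrite /bernoulli_weight -(pair_bigA _ (fun i j => if D i j then Z i j else 1 - Z i j)) /=.
  apply: eq_bigr => i _; apply: eq_bigr => j _; rewrite /l.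
  have [Wij|/negbTE Wij] := boolP (W i j); last first.
    have := DW _ _ Wij; rewrite mxE; case: (D i j) => [/eqP|_]; first by rewrite oner_eq0.
    by rewrite ZW // subr0 ln1 expR0.
  by have /andP[? ?] := Zint Wij; case: (D i j); rewrite lnK // posrE ?subr_gt0.
rewrite ler_expR -subr_ge0; have -> : \sum_i \sum_j l i j - (- entropy Z) = 
   - \sum_i \sum_j (real_mx R D i j - Z i j) * (ln (1 - Z i j) - ln (Z i j)).
  rewrite opprK /entropy -big_split -sumrN /=; apply: eq_bigr => i _.
  rewrite -big_split -sumrN /=; apply: eq_bigr => j _; rewrite -/(bin_entropy _) /l.
  have [Wij|/negbTE Wij] := boolP (W i j); last first.
    have := DW _ _ Wij; rewrite !mxE; case: (D i j) => [/eqP|_]; first by rewrite oner_eq0.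
    by rewrite ZW // bin_entropy0 !subr0 ln1 !mul0r addr0 oppr0.
  by rewrite bin_entropyE ?Zint // mxE; case: (D i j); rewrite /=; ring.
by rewrite oppr_ge0.
Qed.

(** The expectation factors over the entries, and [1 + z * (expR t - 1) <= expR (z * (expR t - 1))]
    on each entry of [S]. *)
Lemma bernoulli_laplace (S : {set 'I_m * 'I_n}) t :
  \sum_D bernoulli_weight D * expR (t * sigma S (real_mx R D)) <=
  expR (sigma S Z * (expR t - 1)).
Proof.
have [[_ _ Z01 _] _] := maxZ.
pose f (p : 'I_m * 'I_n) := Z p.1 p.2 * (if p \in S then expR t else 1).
have -> : \sum_D bernoulli_weight D * expR (t * sigma S (real_mx R D)) =
    \prod_(p : 'I_m * 'I_n) (f p + (1 - Z p.1 p.2)).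
  rewrite (reindex (@indicator_mx m n)) /=; last exact/onW_bij/indicator_mx_bij.
  rewrite bigA_distr; apply: eq_bigr => A _.
  rewrite /sigma mulr_sumr expR_sum [X in _ * X]big_mkcond -big_split /=.
  apply: eq_bigr => -[i j] _; rewrite !mxE /f /=.
  case: ((i, j) \in A); case: ((i, j) \in S); rewrite ?mulr1 ?mulr0 ?expR0 ?mulr1 //.
rewrite /sigma mulr_suml expR_sum [leRHS]big_mkcond /=; apply: ler_prod => -[i j] _.
rewrite /f /=; have /andP[z0 z1] := Z01 i j; have et := expR_gt0 t.
apply/andP; split.
  by rewrite addr_ge0 ?subr_ge0 // mulr_ge0 //; case: ifP => _; rewrite ?expR_ge0.
case: ifP => _; last by rewrite mulr1 subrKC.
by apply: le_trans (expR_ge1Dx _); lra.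
Qed.

(** Markov's inequality for the exponential moment, turned into a count by the lower bound on the
    Bernoulli weights. Either sign of [t] is allowed, so both tails are covered. *)
Lemma tail_bound (S : {set 'I_m * 'I_n}) (B : {set 'M[bool]_(m, n)}) t theta :
  B \subset zero_one_matrices r c W ->
  (forall D, D \in B -> t * theta <= t * sigma S (real_mx R D)) ->
  #|B|%:R <= expR (entropy Z + sigma S Z * (expR t - 1) - t * theta).
Proof.
move=> /subsetP BS Bt; have [[_ _ Z01 _] _] := maxZ.
rewrite expRD expRN ler_pdivlMr ?expR_gt0 // expRD -ler_pdivrMl ?expR_gt0 // -expRN.
apply: le_trans (bernoulli_laplace S t).
apply: (@le_trans _ _ (\sum_(D in B) bernoulli_weight D * expR (t * sigma S (real_mx R D)))).
  rewrite mulrCA mulr_natl -sumr_const; apply: ler_sum => D DB.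
  by apply: ler_pM; rewrite ?expR_ge0 ?ler_expR ?Bt // bernoulli_weight_ge // BS.
rewrite [leLHS]big_mkcond; apply: ler_sum => D _; case: ifP => // _.
rewrite mulr_ge0 ?expR_ge0 //; apply: prodr_ge0 => -[i j] _ /=.
by have /andP[? ?] := Z01 i j; case: ifP => _ //; rewrite subr_ge0.
Qed.

Lemma deviation_bound (S : {set 'I_m * 'I_n}) (epsilon : R) :
  0 <= epsilon <= 1 -> 0 <= sigma S Z ->
  #|[set D in zero_one_matrices r c W |
      ~~ ((1 - epsilon) * sigma S Z <= sigma S (real_mx R D) <=
          (1 + epsilon) * sigma S Z)]|%:R <=
  2 * expR (entropy Z - sigma S Z * epsilon ^+ 2 / 8).
Proof.
move=> /andP[e0 e1] s0; set G := zero_one_matrices r c W.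
pose lo := [set D in G | sigma S (real_mx R D) < (1 - epsilon) * sigma S Z]%SET.
pose hi := [set D in G | (1 + epsilon) * sigma S Z < sigma S (real_mx R D)]%SET.
(* The condition on [t * theta] says [theta = (1 + epsilon) * sigma S Z] or
   [(1 - epsilon) * sigma S Z], according to the sign of [t]. The exponent beyond the entropy is
   then at most [- 2 * t ^+ 2 * sigma S Z]. *)
have side (B : {set 'M[bool]_(m, n)}) t theta : B \subset G -> `|t| = epsilon / 4 ->
    t * theta = t * sigma S Z + t ^+ 2 * 4 * sigma S Z ->
    (forall D, D \in B -> t * theta <= t * sigma S (real_mx R D)) ->
    #|B|%:R <= expR (entropy Z - sigma S Z * epsilon ^+ 2 / 8).
  move=> BG te th Bt; apply: le_trans (tail_bound BG Bt) _; rewrite ler_expR -addrA lerD2l th.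
  have t2 : t ^+ 2 = epsilon ^+ 2 / 16 by rewrite -real_normK ?num_real // te; field.
  have := @expR_le_quadratic R t; rewrite te => /(_ ltac:(lra)) q.
  have : sigma S Z * (expR t - 1) <= sigma S Z * (t + 2 * t ^+ 2).
    by rewrite ler_wpM2l //; lra.
  rewrite t2; lra.
apply: (@le_trans _ _ (#|lo|%:R + #|hi|%:R)).
  rewrite -natrD ler_nat; apply: leq_trans (leq_card_setU lo hi).
  apply/subset_leq_card/subsetP => D; rewrite !inE => /andP[-> /=].
  by rewrite negb_and -!ltNge.
rewrite mulr_natl mulr2n; apply: lerD.
- apply: (@side lo (- (epsilon / 4)) ((1 - epsilon) * sigma S Z)).
  + by apply/subsetP => D; rewrite inE => /andP[].
  + by rewrite normrN ger0_norm //; lra.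
  + by field.
  + move=> D; rewrite inE => /andP[_ /ltW]; rewrite !mulNr lerN2 => H.
    by rewrite ler_wpM2l //; lra.
- apply: (@side hi (epsilon / 4) ((1 + epsilon) * sigma S Z)).
  + by apply/subsetP => D; rewrite inE => /andP[].
  + by rewrite ger0_norm //; lra.
  + by field.
  + by move=> D; rewrite inE => /andP[_ /ltW] H; rewrite ler_wpM2l //; lra.
Qed.

End Concentration.

(** * Choice of the threshold and final estimate *)

Theorem theorem2p4 (R : realType) (kappa delta : R)
    (hkappa : 0 < kappa) (hdelta : 0 < delta < 1) :
  exists q : R, forall (m n : nat) (r : 'I_m -> nat) (c : 'I_n -> nat)
      (W : 'M[bool]_(m, n)),
    (m <= n)%N -> q < m%:R ->
    (\sum_i r i = \sum_j c j)%N ->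
    (forall i, 0 < r i < n)%N ->
    (forall j, 0 < c j < m)%N ->
    (exists2 Y : 'M[R]_(m, n), polytope r c W Y &
       forall i j, W i j -> 0 < Y i j < 1) ->
    forall (Z : 'M[R]_(m, n)) (S : {set 'I_m * 'I_n}),
      is_maximizer (polytope r c W) (@entropy R m n) Z ->
      (forall i j, (i, j) \in S -> W i j) ->
      delta * m%:R * n%:R <= sigma S Z ->
      let epsilon := delta * (ln n%:R / Num.sqrt m%:R) in
      epsilon <= 1 ->
      1 - 2 * n%:R `^ (- (kappa * n%:R)) <=
      uniform_pr R (zero_one_matrices r c W)
        (fun D => (1 - epsilon) * sigma S Z <= sigma S (real_mx R D)
                  <= (1 + epsilon) * sigma S Z).
Proof.
have /andP[d0 d1] := hdelta.
(* Chosen so that [ln n >= L] gives [delta ^+ 3 * ln n / 8 >= kappa + 4]: the 8 comes from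
   [deviation_bound], and the 4 absorbs the counting loss [n ^ (4 n)]. *)
pose L := 8 * (kappa + 4) / delta ^+ 3.
exists (2 + expR L) => m n r c W mn qm _ _ _ [Y PY Y01] Z S maxZ _ dS /= e1.
set epsilon := delta * _ in e1 *; set G := zero_one_matrices r c W.
have Zint := maximizer_interior PY Y01 maxZ.
have eL := expR_gt0 L.
have mnR : (m%:R : R) <= n%:R by rewrite ler_nat.
have m0 : (0 : R) < m%:R by lra.
have n2 : (2 : R) <= n%:R by lra.
have n0 : (0 : R) < n%:R by lra.
have lnL : L <= ln n%:R by rewrite -[L]expRK ler_ln ?posrE //; lra.
have ln0 : 0 <= ln (n%:R : R) by apply: ln_ge0; lra.
have s0 : 0 <= sigma S Z by apply: le_trans dS; rewrite !mulr_ge0 // ltW.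
have e0 : 0 <= epsilon by rewrite /epsilon !mulr_ge0 ?invr_ge0 ?sqrtr_ge0 // ltW.
have dev : #|[set D in G | ~~ ((1 - epsilon) * sigma S Z <= sigma S (real_mx R D) <=
    (1 + epsilon) * sigma S Z)]|%:R <= 2 * expR (entropy Z - sigma S Z * epsilon ^+ 2 / 8).
  by apply: deviation_bound => //; rewrite e0.
have cnt := expR_entropy_le_card (proj1 maxZ) Zint; rewrite -/G in cnt.
(* Both bases are at most [n.+1 <= n ^+ 2], and both exponents at most [n]. *)
have Qle : (n.+1%:R ^+ m * m.+1%:R ^+ n : R) <= expR (4 * n%:R * ln n%:R).
  have sq : n.+1%:R <= (n%:R : R) ^+ 2 by rewrite -natr1; nra.
  have n1 : 1 <= n.+1%:R :> R by rewrite ler1n.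
  have -> : expR (4 * n%:R * ln n%:R) = ((n%:R : R) ^+ 2) ^+ n * ((n%:R : R) ^+ 2) ^+ n.
    rewrite -!exprM -exprD -[in RHS](@lnK _ n%:R) ?posrE // -expRM_natl; congr expR.
    by rewrite natrD natrM; ring.
  have up k : (k <= n)%N -> (k.+1%:R : R) ^+ n <= (n%:R ^+ 2) ^+ n.
    by move=> kn; rewrite lerXn2r ?nnegrE ?sqr_ge0 // (le_trans _ sq) // ler_nat.
  apply: ler_pM; rewrite ?exprn_ge0 // ?up //.
  by apply: le_trans (up n (leqnn n)); rewrite ler_weXn2l.
have G0 : (0 : R) < #|G|%:R.
  rewrite ltr0n lt0n; apply/negP => /eqP G0; move: cnt; rewrite G0 mulr0.
  by rewrite leNgt expR_gt0.
(* The factor [m] in the lower bound on [sigma S Z] cancels the one in [epsilon ^+ 2], leaving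
   [delta ^+ 3 * n * (ln n) ^+ 2]. *)
have expo : 4 * n%:R * ln n%:R - sigma S Z * epsilon ^+ 2 / 8 <= - (kappa * n%:R) * ln n%:R.
  have e2 : epsilon ^+ 2 = delta ^+ 2 * ln n%:R ^+ 2 / m%:R.
    by rewrite /epsilon !exprMn exprVn sqr_sqrtr ?ltW // mulrA.
  have : delta * m%:R * n%:R * epsilon ^+ 2 <= sigma S Z * epsilon ^+ 2.
    by rewrite ler_wpM2r ?sqr_ge0.
  have -> : delta * m%:R * n%:R * epsilon ^+ 2 = (delta ^+ 3 * ln n%:R) * (n%:R * ln n%:R).
    by rewrite e2; field; rewrite gt_eqF.
  have : 8 * (kappa + 4) * (n%:R * ln n%:R) <= (delta ^+ 3 * ln n%:R) * (n%:R * ln n%:R).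
    rewrite ler_wpM2r ?mulr_ge0 // [leRHS]mulrC.
    by move: lnL; rewrite /L ler_pdivrMr ?exprn_gt0.
  lra.
set E := (X in uniform_pr R G X).
rewrite /uniform_pr /powR gt_eqF // ler_pdivlMr //.
have split : #|[set x in G | E x]|%:R + #|[set D in G | ~~ E D]|%:R = #|G|%:R :> R.
  rewrite -natrD; congr (_%:R).
  rewrite -(cardsID [set D | E D] G); congr addn; apply: eq_card => D; rewrite !inE //.
  by rewrite andbC.
suff : #|[set D in G | ~~ E D]|%:R <= 2 * expR (- (kappa * n%:R) * ln n%:R) * #|G|%:R :> R.
  lra.
apply: le_trans dev _; rewrite -[leRHS]mulrA ler_pM2l ?ltr0n //.
rewrite expRD; apply: le_trans (ler_wpM2r (expR_ge0 _) cnt) _.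
rewrite mulrAC ler_pM2r //; apply: le_trans (ler_wpM2r (expR_ge0 _) Qle) _.
by rewrite -expRD ler_expR.
Qed.
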